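(* Suppose $h$ is analytic in $\mathbb{D}=\{z\in\mathbb{C}:|z|<1\}$. If $0\le r\le\frac13\left(1-\sqrt{\frac23}\right)$, then $$B_r\left((h\circ\varphi)'\right)\le B_r(h')$$ for every Schwarz function $\varphi$.
   Context: For $g(z)=\sum_{n=0}^{\infty}c_nz^n$ analytic in $\mathbb{D}$, the Bohr operator is $B_r(g)=\sum_{n=0}^{\infty}|c_n|r^n$ for $0\le r<1$. A Schwarz function is an analytic function $\varphi:\mathbb{D}\to\mathbb{D}$ with $\varphi(0)=0$. *)

(* Defs.v *)
From Stdlib Require Import Reals ClassicalEpsilon.
From Coquelicot Require Import Coquelicot.

Local Open Scope R_scope.

(* [C] alone is the binomial coefficient of Stdlib's Reals. *)
Notation CC := Coquelicot.Complex.C.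

Definition in_disc (z : CC) : Prop := Cmod z < 1.

(* Functions are total on CC; their values outside the disc are irrelevant. *)
Definition analytic_in_disc (g : CC -> CC) : Prop :=
  forall z0 : CC, in_disc z0 ->
    exists (a : nat -> CC) (rho : R), 0 < rho /\
      forall z : CC, Cmod (z - z0)%C < rho ->
        @is_pseries C_AbsRing C_NormedModule a (z - z0)%C (g z).

Definition is_expansion (c : nat -> CC) (g : CC -> CC) : Prop :=
  forall z : CC, in_disc z -> @is_pseries C_AbsRing C_NormedModule c z (g z).

(* The sequence c with g(z) = sum_n c_n z^n on the whole disc; such a sequence
   is unique, and it exists when g is analytic in the disc. *)
Definition coefs (g : CC -> CC) : nat -> CC :=
  epsilon (inhabits (fun _ : nat => RtoC 0)) (fun c => is_expansion c g).

Definition Bohr (r : R) (g : CC -> CC) : R :=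
  Series (fun n : nat => Cmod (coefs g n) * r ^ n).

Definition Schwarz_function (phi : CC -> CC) : Prop :=
  analytic_in_disc phi /\
  (forall z : CC, in_disc z -> in_disc (phi z)) /\
  phi (RtoC 0) = RtoC 0.

(* Main.v *)
Require Import Defs.
From Stdlib Require Import Reals Lra Lia Factorial ClassicalEpsilon.
From Coquelicot Require Import Coquelicot.
Local Open Scope R_scope.

(** Let [h = sum a_n z^n] and [phi = z * psi].  Then
    [h (phi z) = sum_n a_n z^n (psi z)^n], so with [q_(n,j)] the Taylor
    coefficients of [psi^n] the Bohr sum of [(h o phi)'] is at most
    [sum_n |a_n| sum_j (n + j) |q_(n,j)| r^(n - 1 + j)], while that of [h'] is
    [sum_n |a_n| n r^(n - 1)], with [n >= 1] in both.  It suffices to compare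
    them term by term.  As [n + j <= n (1 + j)], this amounts to
    [sum_j (1 + j) |q_(n,j)| r^j <= 1] ([weighted_coef_sum]).

    By the Schwarz lemma [psi^n] is bounded by 1, and a function
    [q = sum q_j z^j] bounded by 1 satisfies the Carathéodory inequality
    [|q_j| <= 2 (1 - |q_0|)] for [j >= 1] ([Schwarz_power_coef]).  The weighted
    sum is therefore at most the convex combination
    [|q_0| * 1 + (1 - |q_0|) * 2 sum_(j >= 1) (1 + j) r^j], and since
    [1 + j <= 2^j] and [2 r <= 1/3], the second value is at most
    [2 sum_(j >= 1) 3^-j = 1].

    The Carathéodory inequality ([caratheodory]) comes from averaging a partial
    sum over roots of unity on a circle: if [Re p >= 0], the average of
    [Re p(z) * z^-n] is at most the average of [Re p], and orthogonality of the
    characters identifies these averages, on the unit circle, with [p_n / 2] and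
    [Re p_0].  Besides the inequality itself, this gives a Cauchy estimate
    ([coef_bound]) and the uniqueness of coefficients ([pseries_unique]).

    Analyticity is given by local power series, whereas the Bohr operator
    speaks of one expansion valid on the whole disc.  That the Taylor series at
    0 converges to the function on the whole disc ([analytic_expansion]) is
    proved by continuation.  Let [rho] be the supremum of the radii where this
    holds, and suppose [rho < 1].  By compactness, at every [z0] of the disc of
    radius [rho] the function has a power series with coefficients [b_k(z0)]
    bounded by [M delta^-k], with the same [delta] and [M] for all [z0].
    For [|z0| < rho] one has [b_k(z0) = sum_j C(j + k, k) c_(j + k) z0^j], and
    the Cauchy estimate for this function of [z0] bounds
    [C(j + k, k) |c_(j + k)| rho^j delta^k].  Summing over [j + k = n] with
    [delta] halved gives a bound on [|c_n| (rho + delta / 2)^n]: the series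
    converges beyond [rho], and by re-expansion at points just inside the circle
    it still represents the function there. *)

(* Lemmas on sums in an abstract structure leave equations typed by the sort of
   that structure, which [ring] and [field] do not recognise. *)
Ltac C_eq := match goal with |- ?a = ?b => change (@eq CC a b) end;
  repeat match goal with |- context [@plus _ ?a ?b] => change (plus a b) with (Cplus a b) end.

Ltac R_eq := match goal with |- ?a = ?b => change (@eq R a b) end.

(** * Double series *)

(** Absolute summability of a nonnegative double family, in iterated form;
    [tonelli_half] shows that the order of summation is immaterial. *)
Definition summable2 (w : nat -> nat -> R) : Prop :=
  (forall n, ex_series (w n)) /\ ex_series (fun n => Series (w n)).

Lemma ex_series_le_pos (a b : nat -> R) :
  (forall n, 0 <= a n <= b n) -> ex_series b -> ex_series a.
Proof.
  intros H. apply (@ex_series_le R_AbsRing R_CompleteNormedModule).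
  intros n. change (Rabs (a n) <= b n). rewrite Rabs_pos_eq; apply H.
Qed.

Lemma sum_n_nonneg (a : nat -> R) n : (forall k, 0 <= a k) -> 0 <= sum_n a n.
Proof.
  intros H. induction n. rewrite sum_O. apply H.
  rewrite sum_Sn. apply Rplus_le_le_0_compat; auto.
Qed.

Lemma sum_n_le_loc (a b : nat -> R) n :
  (forall k, (k <= n)%nat -> a k <= b k) -> sum_n a n <= sum_n b n.
Proof.
  induction n; intros H.
  - rewrite !sum_O. apply H; lia.
  - rewrite !sum_Sn. apply Rplus_le_compat; [apply IHn; intros; apply H|apply H]; lia.
Qed.

Lemma ex_series_bounded_sums (a : nat -> R) (M : R) :
  (forall n, 0 <= a n) -> (forall n, sum_n a n <= M) ->
  ex_series a /\ Series a <= M.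
Proof.
  intros Ha HM.
  assert (E : ex_finite_lim_seq (sum_n a)).
  { apply ex_finite_lim_seq_incr with M; auto.
    intros n. rewrite sum_Sn. unfold plus; simpl. generalize (Ha (S n)); lra. }
  destruct E as [l Hl].
  split.
  - exists l. exact Hl.
  - rewrite (is_series_unique a l Hl).
    apply (is_lim_seq_le (sum_n a) (fun _ => M) l M HM Hl (is_lim_seq_const M)).
Qed.

Lemma sum_n_le_Series (a : nat -> R) n :
  (forall k, 0 <= a k) -> ex_series a -> sum_n a n <= Series a.
Proof.
  intros Ha Hs.
  apply (is_lim_seq_incr_compare (sum_n a) (Series a)).
  - exact (Series_correct _ Hs).
  - intros k. rewrite sum_Sn. unfold plus; simpl. generalize (Ha (S k)); lra.
Qed.

Lemma term_le_Series (a : nat -> R) n :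
  (forall k, 0 <= a k) -> ex_series a -> a n <= Series a.
Proof.
  intros Ha Hs. apply Rle_trans with (sum_n a n).
  - destruct n. rewrite sum_O; lra. rewrite sum_Sn. unfold plus; simpl.
    generalize (sum_n_nonneg a n Ha); lra.
  - apply sum_n_le_Series; auto.
Qed.

Lemma Series_nonneg (a : nat -> R) : (forall n, 0 <= a n) -> ex_series a -> 0 <= Series a.
Proof. intros Ha Hs. apply Rle_trans with (a 0%nat); auto using term_le_Series. Qed.

Lemma is_series_sum_n (u : nat -> nat -> R) K :
  (forall k, ex_series (fun n => u n k)) ->
  is_series (fun n => sum_n (u n) K) (sum_n (fun k => Series (fun n => u n k)) K).
Proof.
  intros H. induction K.
  - rewrite sum_O. apply is_series_ext with (fun n => u n 0%nat).
    intros; now rewrite sum_O. apply Series_correct, H.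
  - rewrite sum_Sn. apply is_series_ext with (fun n => plus (sum_n (u n) K) (u n (S K))).
    intros; now rewrite sum_Sn.
    apply (is_series_plus (fun n => sum_n (u n) K) (fun n => u n (S K))); auto. apply Series_correct, H.
Qed.

(** Each partial sum of the column sums is a sum over the rows of partial row
    sums, hence is bounded by the total of the rows.  Exchanging the roles of
    rows and columns yields the converse inequality. *)
Lemma tonelli_half (u : nat -> nat -> R) :
  (forall n k, 0 <= u n k) -> summable2 u ->
  summable2 (fun k n => u n k) /\
  Series (fun k => Series (fun n => u n k)) <= Series (fun n => Series (u n)).
Proof.
  intros Hu [Hr Ht].
  assert (Hc : forall k, ex_series (fun n => u n k)).
  { intros k. apply ex_series_le_pos with (fun n => Series (u n)); auto.
    intros n; split; auto. apply (term_le_Series (u n)); auto. }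
  destruct (ex_series_bounded_sums (fun k => Series (fun n => u n k)) (Series (fun n => Series (u n)))).
  - intros k. apply Series_nonneg; auto.
  - intros K. rewrite <- (is_series_unique _ _ (is_series_sum_n u K Hc)).
    apply Series_le; auto. intros n; split.
    apply sum_n_nonneg; auto. apply sum_n_le_Series; auto.
  - repeat split; auto.
Qed.

Lemma tonelli (u : nat -> nat -> R) :
  (forall n k, 0 <= u n k) -> summable2 u ->
  Series (fun k => Series (fun n => u n k)) = Series (fun n => Series (u n)).
Proof.
  intros Hu Hs. destruct (tonelli_half u Hu Hs) as [H1 H2].
  apply Rle_antisym; auto.
  apply (tonelli_half (fun k n => u n k)); auto.
Qed.

Lemma summable2_le (u w : nat -> nat -> R) :
  (forall n k, 0 <= u n k <= w n k) -> summable2 w -> summable2 u.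
Proof.
  intros H [Hr Ht].
  assert (Hr' : forall n, ex_series (u n)) by (intros; apply ex_series_le_pos with (w n); auto).
  split; auto. apply ex_series_le_pos with (fun n => Series (w n)); auto.
  intros n; split. apply Series_nonneg; auto. apply H. apply Series_le; auto.
Qed.

Lemma summable2_plus (u w : nat -> nat -> R) :
  summable2 u -> summable2 w -> summable2 (fun n k => u n k + w n k).
Proof.
  intros [Hr Ht] [Hr' Ht']. split.
  - intros n. apply (ex_series_plus (u n) (w n)); auto.
  - apply ex_series_ext with (fun n => Series (u n) + Series (w n)).
    intros; now rewrite Series_plus. apply (ex_series_plus (fun n => Series (u n)) (fun n => Series (w n))); auto.
Qed.

Lemma Series_Rabs_le (a b : nat -> R) :
  (forall n, Rabs (a n) <= b n) -> ex_series b -> ex_series a /\ Rabs (Series a) <= Series b.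
Proof.
  intros H Hb.
  assert (Ha : ex_series (fun n => Rabs (a n))).
  { apply ex_series_le_pos with b; auto. intros; split; auto. apply Rabs_pos. }
  split. now apply ex_series_Rabs.
  apply Rle_trans with (1 := Series_Rabs a Ha). apply Series_le; auto.
  intros; split; auto. apply Rabs_pos.
Qed.

Lemma summable2_Rabs (u w : nat -> nat -> R) :
  (forall n k, Rabs (u n k) <= w n k) -> summable2 w ->
  (forall n, ex_series (u n)) /\ ex_series (fun n => Series (u n)).
Proof.
  intros H [Hr Ht].
  split. intros n; apply (Series_Rabs_le (u n) (w n)); auto.
  apply (Series_Rabs_le _ (fun n => Series (w n))); auto.
  intros n; apply (Series_Rabs_le (u n) (w n)); auto.
Qed.

(** Apply [tonelli] to [w] and to the nonnegative family [w - u], and subtract. *)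
Lemma fubini (u w : nat -> nat -> R) :
  (forall n k, Rabs (u n k) <= w n k) -> summable2 w ->
  Series (fun k => Series (fun n => u n k)) = Series (fun n => Series (u n)).
Proof.
  intros H Hw.
  assert (Hw0 : forall n k, 0 <= w n k) by (intros n k; apply Rle_trans with (2 := H n k), Rabs_pos).
  assert (B : forall n k, 0 <= w n k - u n k <= w n k + w n k).
  { intros n k. generalize (H n k). unfold Rabs; destruct Rcase_abs; lra. }
  assert (Hd : summable2 (fun n k => w n k - u n k)).
  { apply summable2_le with (fun n k => w n k + w n k); auto using summable2_plus. }
  assert (Ed := tonelli _ (fun n k => proj1 (B n k)) Hd).
  cbv beta in Ed.
  assert (Ew := tonelli w Hw0 Hw).
  destruct (tonelli_half w Hw0 Hw) as [Hw' _].
  destruct (summable2_Rabs u w H Hw) as [A1 A2].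
  destruct (summable2_Rabs (fun k n => u n k) (fun k n => w n k) (fun k n => H n k) Hw') as [A3 A4].
  destruct Hw as [W1 W2]. destruct Hw' as [W3 W4].
  rewrite (Series_ext (fun n => Series (fun k => w n k - u n k)) (fun n => Series (w n) - Series (u n))) in Ed
    by (intros; apply Series_minus; auto).
  rewrite (Series_ext (fun k => Series (fun n => w n k - u n k))
     (fun k => Series (fun n => w n k) - Series (fun n => u n k))) in Ed
    by (intros; apply Series_minus; auto).
  rewrite !Series_minus in Ed; auto. lra.
Qed.

(** The row [f] moved [k] places to the right: placing row [k] of a family in
    this way turns its anti-diagonals into columns, so that sums along
    anti-diagonals become an instance of [fubini]. *)
Definition shifted (k : nat) (f : nat -> R) (n : nat) : R :=
  if Nat.leb k n then f (n - k)%nat else 0.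

Lemma shifted_add k f j : shifted k f (k + j) = f j.
Proof.
  unfold shifted. destruct (Nat.leb_spec k (k + j)); [|lia]. f_equal; lia.
Qed.

Lemma ex_series_shifted k f : ex_series (shifted k f) <-> ex_series f.
Proof.
  rewrite (ex_series_incr_n (shifted k f) k).
  split; apply ex_series_ext; intros j; now rewrite shifted_add.
Qed.

Lemma Series_shifted k f : Series (shifted k f) = Series f.
Proof.
  rewrite (Series_incr_n_aux (shifted k f) k).
  apply Series_ext; intros j; apply shifted_add.
  intros j Hj. unfold shifted. destruct (Nat.leb_spec k j); auto; lia.
Qed.

Lemma is_series_finite (a : nat -> R) n :
  (forall k, (n < k)%nat -> a k = 0) -> is_series a (sum_n a n).
Proof.
  intros H.
  change (is_lim_seq (sum_n a) (sum_n a n)).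
  apply is_lim_seq_ext_loc with (fun _ => sum_n a n); [|apply is_lim_seq_const].
  exists n. intros m Hm. induction Hm; auto.
  rewrite sum_Sn, <- IHHm, (H (S m)) by lia. symmetry; apply Rplus_0_r.
Qed.

Lemma is_series_row (v : nat -> nat -> R) n :
  is_series (fun k => shifted k (v k) n) (sum_n (fun k => v k (n - k)%nat) n).
Proof.
  rewrite (sum_n_ext_loc (fun k => v k (n - k)%nat) (fun k => shifted k (v k) n)).
  - apply is_series_finite. intros k Hk. unfold shifted. destruct (Nat.leb_spec k n); auto; lia.
  - intros k Hk. unfold shifted. destruct (Nat.leb_spec k n); auto; lia.
Qed.

Lemma diag_summable2 (w : nat -> nat -> R) :
  (forall k j, 0 <= w k j) ->
  ex_series (fun n => sum_n (fun k => w k (n - k)%nat) n) -> summable2 w.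
Proof.
  intros H Hs.
  assert (Hp : forall k n, 0 <= shifted k (w k) n).
  { intros k n. unfold shifted. destruct (Nat.leb k n); auto; lra. }
  destruct (tonelli_half (fun n k => shifted k (w k) n)) as [[H1 H2] _]; auto.
  - split. intros n; eexists; apply is_series_row.
    eapply ex_series_ext; [|exact Hs]. intros n; symmetry; apply is_series_unique, is_series_row.
  - split. intros k. now apply (ex_series_shifted k).
    eapply ex_series_ext; [|exact H2]. intros k; apply Series_shifted.
Qed.

(** The one rearrangement behind Cauchy products, re-expansion about another
    centre, composition, and the final comparison of Bohr sums. *)
Lemma diag_series (v w : nat -> nat -> R) :
  (forall k j, Rabs (v k j) <= w k j) -> summable2 w ->
  is_series (fun n => sum_n (fun k => v k (n - k)%nat) n)
    (Series (fun k => Series (v k))).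
Proof.
  intros H [Hr Ht].
  assert (H' : forall k n, Rabs (shifted k (v k) n) <= shifted k (w k) n).
  { intros k n. unfold shifted. destruct (Nat.leb k n); auto. rewrite Rabs_R0; lra. }
  assert (Hw : summable2 (fun k n => shifted k (w k) n)).
  { split. intros k. now apply (ex_series_shifted k).
    eapply ex_series_ext; [|exact Ht]. intros k; symmetry; apply Series_shifted. }
  assert (E := fubini (fun k n => shifted k (v k) n) (fun k n => shifted k (w k) n) H' Hw).
  cbv beta in E.
  rewrite (Series_ext (fun k => Series (fun n => shifted k (v k) n)) (fun k => Series (v k))) in E
    by (intros; apply Series_shifted).
  rewrite <- E.
  assert (Hw' : summable2 (fun n k => shifted k (w k) n)).
  { apply (tonelli_half (fun k n => shifted k (w k) n)); auto.
    intros k n; apply Rle_trans with (2 := H' k n), Rabs_pos. }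
  destruct (summable2_Rabs (fun n k => shifted k (v k) n) _ (fun n k => H' k n) Hw') as [_ E2].
  rewrite (Series_ext (fun n => Series (fun k => shifted k (v k) n))
    (fun n => sum_n (fun k => v k (n - k)%nat) n)).
  apply Series_correct. eapply ex_series_ext; [|exact E2].
  all: intros n; apply is_series_unique, is_series_row.
Qed.

(** * Complex series *)

Definition CSeries (u : nat -> CC) : CC :=
  (Series (fun n => Re (u n)), Series (fun n => Im (u n))).

Lemma Re_sum_n (u : nat -> CC) n : Re (sum_n u n) = sum_n (fun k => Re (u k)) n.
Proof. induction n. now rewrite !sum_O. rewrite !sum_Sn, <- IHn. reflexivity. Qed.

Lemma Im_sum_n (u : nat -> CC) n : Im (sum_n u n) = sum_n (fun k => Im (u k)) n.
Proof. induction n. now rewrite !sum_O. rewrite !sum_Sn, <- IHn. reflexivity. Qed.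

Definition is_Cseries (u : nat -> CC) (l : CC) : Prop :=
  @is_series C_AbsRing C_NormedModule u l.

Lemma is_Cseries_iff (u : nat -> CC) (l : CC) :
  is_Cseries u l <->
  is_series (fun n => Re (u n)) (Re l) /\ is_series (fun n => Im (u n)) (Im l).
Proof.
  unfold is_Cseries, is_series. split.
  - intros H; split; apply filterlim_locally; intros eps;
      generalize (proj1 (filterlim_locally _ _) H eps); apply filter_imp;
      intros n [H1 H2]; [rewrite <- Re_sum_n|rewrite <- Im_sum_n]; assumption.
  - intros [H1 H2]. apply filterlim_locally; intros eps.
    generalize (filter_and _ _ (proj1 (filterlim_locally _ _) H1 eps)
                               (proj1 (filterlim_locally _ _) H2 eps)).
    apply filter_imp. intros n. rewrite <- Re_sum_n, <- Im_sum_n. intros [A B]; split; assumption.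
Qed.

Lemma CSeries_unique u l : is_Cseries u l -> CSeries u = l.
Proof.
  intros H. apply is_Cseries_iff in H. destruct H as [H1 H2].
  unfold CSeries. rewrite (is_series_unique _ _ H1), (is_series_unique _ _ H2).
  now destruct l.
Qed.

Lemma im_le_Cmod (c : CC) : Rabs (Im c) <= Cmod c.
Proof. apply Rle_trans with (2 := Rmax_Cmod c), Rmax_r. Qed.

Lemma CSeries_correct u : ex_series (fun n => Cmod (u n)) -> is_Cseries u (CSeries u).
Proof.
  intros H. apply is_Cseries_iff; split; apply Series_correct.
  - apply (Series_Rabs_le _ (fun n => Cmod (u n))); auto. intros; apply re_le_Cmod.
  - apply (Series_Rabs_le _ (fun n => Cmod (u n))); auto. intros; apply im_le_Cmod.
Qed.

Lemma CSeries_ext u v : (forall n, u n = v n) -> CSeries u = CSeries v.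
Proof. intros H. unfold CSeries. f_equal; apply Series_ext; intros; now rewrite H. Qed.

Lemma Cmod_sum_n (u : nat -> CC) n : Cmod (sum_n u n) <= sum_n (fun k => Cmod (u k)) n.
Proof.
  induction n. rewrite !sum_O; lra.
  rewrite !sum_Sn. apply Rle_trans with (1 := Cmod_triangle _ _).
  now apply Rplus_le_compat_r.
Qed.

Lemma Cmod_series_le (u : nat -> CC) l M :
  is_Cseries u l -> (forall n, Cmod (sum_n u n) <= M) -> Cmod l <= M.
Proof.
  intros H HM.
  apply (filterlim_le (F := eventually) (fun n => Cmod (sum_n u n)) (fun _ => M) (Cmod l) M).
  - apply filter_forall; auto.
  - apply filterlim_comp with (2 := @filterlim_norm C_AbsRing C_NormedModule l). exact H.
  - apply filterlim_const.
Qed.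

Lemma Cmod_CSeries_le u : ex_series (fun n => Cmod (u n)) ->
  Cmod (CSeries u) <= Series (fun n => Cmod (u n)).
Proof.
  intros H. apply Cmod_series_le with u. now apply CSeries_correct.
  intros n. apply Rle_trans with (1 := Cmod_sum_n u n).
  apply (sum_n_le_Series (fun k => Cmod (u k))); auto. intros; apply Cmod_ge_0.
Qed.

Lemma CSeries_bounded u b : (forall n, Cmod (u n) <= b n) -> ex_series b ->
  ex_series (fun n => Cmod (u n)) /\ Cmod (CSeries u) <= Series b.
Proof.
  intros H Hb.
  assert (E : ex_series (fun n => Cmod (u n))).
  { apply ex_series_le_pos with b; auto. intros; split; auto. apply Cmod_ge_0. }
  split; auto. apply Rle_trans with (1 := Cmod_CSeries_le u E).
  apply Series_le; auto. intros; split; auto. apply Cmod_ge_0.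
Qed.

Lemma Cdiag_series (v : nat -> nat -> CC) :
  summable2 (fun k j => Cmod (v k j)) ->
  is_Cseries (fun n => sum_n (fun k => v k (n - k)%nat) n)
    (CSeries (fun k => CSeries (v k))).
Proof.
  intros H. apply is_Cseries_iff; split.
  - apply is_series_ext with (fun n => sum_n (fun k => Re (v k (n - k)%nat)) n).
    intros; now rewrite Re_sum_n.
    apply (diag_series (fun k j => Re (v k j)) (fun k j => Cmod (v k j))); auto.
    intros; apply re_le_Cmod.
  - apply is_series_ext with (fun n => sum_n (fun k => Im (v k (n - k)%nat)) n).
    intros; now rewrite Im_sum_n.
    apply (diag_series (fun k j => Im (v k j)) (fun k j => Cmod (v k j))); auto.
    intros; apply im_le_Cmod.
Qed.

Lemma diag_ex_series (v : nat -> nat -> CC) :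
  summable2 (fun k j => Cmod (v k j)) ->
  ex_series (fun n => Cmod (sum_n (fun k => v k (n - k)%nat) n)).
Proof.
  intros H.
  apply ex_series_le_pos with (fun n => sum_n (fun k => Cmod (v k (n - k)%nat)) n).
  - intros n; split. apply Cmod_ge_0. apply Cmod_sum_n.
  - eexists. apply (diag_series (fun k j => Cmod (v k j)) (fun k j => Cmod (v k j))); auto.
    intros; rewrite Rabs_pos_eq; try lra. apply Cmod_ge_0.
Qed.

Lemma is_Cseries_scal c u l : is_Cseries u l -> is_Cseries (fun n => (c * u n)%C) (c * l)%C.
Proof. apply (@is_series_scal C_AbsRing C_NormedModule). Qed.

Lemma is_Cseries_plus u v l m : is_Cseries u l -> is_Cseries v m ->
  is_Cseries (fun n => (u n + v n)%C) (l + m)%C.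
Proof. apply (@is_series_plus C_AbsRing C_NormedModule). Qed.

Lemma is_Cseries_decr u l : is_Cseries (fun n => u (S n)) l -> is_Cseries u (u 0%nat + l)%C.
Proof.
  intros H. apply (@is_series_decr_1 C_AbsRing C_NormedModule).
  replace (plus _ _) with l. exact H.
  unfold plus, opp; simpl. ring.
Qed.

Lemma Cpow_pow_n (z : CC) n : @pow_n C_Ring z n = (z ^ n)%C.
Proof. induction n; simpl. reflexivity. now rewrite IHn. Qed.

Lemma is_pseries_Cseries (a : nat -> CC) (z l : CC) :
  @is_pseries C_AbsRing C_NormedModule a z l <-> is_Cseries (fun n => a n * z ^ n)%C l.
Proof.
  unfold is_pseries, is_Cseries.
  assert (E : forall n, scal (@pow_n C_AbsRing z n) (a n) = (a n * z ^ n)%C).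
  { intros n. rewrite <- (Cpow_pow_n z n). apply Cmult_comm. }
  split; apply (@is_series_ext C_AbsRing C_NormedModule); intros n; now rewrite E.
Qed.

(** * Power series *)

Definition abs_conv (a : nat -> CC) (t : R) : Prop :=
  ex_series (fun n => Cmod (a n) * t ^ n).

Definition PS (a : nat -> CC) (z : CC) : CC := CSeries (fun n => a n * z ^ n)%C.

Lemma Cmod_term (a z : CC) n : Cmod (a * z ^ n) = Cmod a * Cmod z ^ n.
Proof. now rewrite Cmod_mult, Cmod_pow. Qed.

Lemma abs_conv_le a s t : 0 <= s <= t -> abs_conv a t -> abs_conv a s.
Proof.
  intros [H1 H2]. apply ex_series_le_pos. intros n; split.
  - apply Rmult_le_pos. apply Cmod_ge_0. now apply pow_le.
  - apply Rmult_le_compat_l. apply Cmod_ge_0. now apply pow_incr.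
Qed.

Lemma abs_conv_terms a z : abs_conv a (Cmod z) ->
  ex_series (fun n => Cmod (a n * z ^ n)).
Proof. apply ex_series_ext. intros n; now rewrite Cmod_term. Qed.

Lemma PS_correct a z : abs_conv a (Cmod z) ->
  is_Cseries (fun n => a n * z ^ n)%C (PS a z).
Proof. intros H. now apply CSeries_correct, abs_conv_terms. Qed.

Lemma PS_unique a z l : @is_pseries C_AbsRing C_NormedModule a z l -> PS a z = l.
Proof. intros H. now apply CSeries_unique, is_pseries_Cseries. Qed.

Lemma abs_conv_bounded a s t M : 0 <= s < t ->
  (forall n, Cmod (a n) * t ^ n <= M) -> abs_conv a s.
Proof.
  intros [Hs Ht] HM. apply ex_series_le_pos with (fun n => M * (s / t) ^ n).
  - intros n. split. apply Rmult_le_pos. apply Cmod_ge_0. now apply pow_le.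
    replace (s ^ n) with (t ^ n * (s / t) ^ n).
    2:{ rewrite <- Rpow_mult_distr. f_equal. field. lra. }
    rewrite <- Rmult_assoc. apply Rmult_le_compat_r; auto.
    apply pow_le. apply Rdiv_le_0_compat; lra.
  - apply (ex_series_scal_l M (fun n => (s / t) ^ n)). apply ex_series_geom.
    rewrite Rabs_pos_eq. apply Rmult_lt_reg_r with t; try lra. field_simplify; lra.
    apply Rdiv_le_0_compat; lra.
Qed.


Lemma is_Cseries_bounded u l : is_Cseries u l -> exists M, forall n, Cmod (u n) <= M.
Proof.
  intros H. apply is_Cseries_iff in H. destruct H as [H1 H2].
  assert (B : forall v m, is_series v m -> exists M, forall n, Rabs (v n) <= M).
  { intros v m Hv. destruct (maj_by_pos v) as [M [_ HM]]; [|now exists M].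
    exists 0. apply is_lim_seq_Reals. apply ex_series_lim_0. now exists m. }
  destruct (B _ _ H1) as [A HA]. destruct (B _ _ H2) as [A' HA'].
  exists (sqrt 2 * Rmax A A'). intros n.
  apply Rle_trans with (1 := Cmod_2Rmax (u n)). apply Rmult_le_compat_l. apply sqrt_pos.
  apply Rmax_lub; [apply Rle_trans with (2 := Rmax_l _ _), HA | apply Rle_trans with (2 := Rmax_r _ _), HA'].
Qed.

Lemma Cmod_RtoC_pos (t : R) : 0 <= t -> Cmod (RtoC t) = t.
Proof. intros H. now rewrite Cmod_R, Rabs_pos_eq. Qed.

(** Convergence at a radius between [t] and [rho] bounds the terms there, so at
    [t] they are dominated by a geometric series. *)
Lemma pseries_abs_conv (a : nat -> CC) (g : CC -> CC) rho t :
  (forall z, Cmod z < rho -> @is_pseries C_AbsRing C_NormedModule a z (g z)) ->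
  0 <= t < rho -> abs_conv a t.
Proof.
  intros H Ht.
  assert (Hm : 0 <= (t + rho) / 2 < rho) by lra.
  assert (P := H (RtoC ((t + rho) / 2))).
  rewrite Cmod_RtoC_pos in P by lra. specialize (P (proj2 Hm)).
  apply is_pseries_Cseries, is_Cseries_bounded in P. destruct P as [M HM].
  apply abs_conv_bounded with ((t + rho) / 2) M. lra.
  intros n. specialize (HM n). now rewrite Cmod_term, Cmod_RtoC_pos in HM by lra.
Qed.

Lemma abs_conv_tail a t : 0 < t -> abs_conv a t -> abs_conv (fun n => a (S n)) t.
Proof.
  intros Ht H. unfold abs_conv in H. rewrite ex_series_incr_1 in H.
  apply (ex_series_scal_l (/ t)) in H. revert H. apply ex_series_ext.
  intros n. unfold scal; simpl; unfold mult; simpl. field. lra.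
Qed.

(** Used to divide by [z] a power series that vanishes at 0, and to split off
    the first two terms when differentiating. *)
Lemma PS_incr a z t : Cmod z <= t -> 0 < t -> abs_conv a t ->
  PS a z = (a 0%nat + z * PS (fun n => a (S n)) z)%C.
Proof.
  intros Hz Ht H. apply CSeries_unique.
  replace (a 0%nat + _)%C with
    (a 0%nat * z ^ 0 + z * PS (fun n => a (S n)) z)%C by (simpl; ring).
  apply (is_Cseries_decr (fun n => (a n * z ^ n)%C)).
  assert (H' : is_Cseries (fun n => a (S n) * z ^ n)%C (PS (fun n => a (S n)) z)).
  { apply PS_correct. apply abs_conv_le with t. split; auto using Cmod_ge_0.
    now apply abs_conv_tail. }
  apply (is_Cseries_scal z) in H'. revert H'.
  apply (@is_series_ext C_AbsRing C_NormedModule). intros n. simpl. ring.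
Qed.

Lemma PS_0 a : PS a 0 = a 0%nat.
Proof.
  apply CSeries_unique. apply is_Cseries_iff.
  split; [generalize (is_series_finite (fun n => Re (a n * 0 ^ n)%C) 0) |
          generalize (is_series_finite (fun n => Im (a n * 0 ^ n)%C) 0)];
  rewrite sum_O; simpl; rewrite !Rmult_1_r, !Rmult_0_r; unfold Re, Im;
  rewrite ?Rminus_0_r, ?Rplus_0_r, ?Rplus_0_l; intros H; apply H; intros k Hk;
  destruct k; try lia; simpl; ring.
Qed.

Lemma Cmod_PS_le a z t : Cmod z <= t -> abs_conv a t ->
  Cmod (PS a z) <= Series (fun n => Cmod (a n) * t ^ n).
Proof.
  intros Hz Ha. apply (CSeries_bounded _ (fun n => Cmod (a n) * t ^ n)); auto.
  intros n. rewrite Cmod_term. apply Rmult_le_compat_l. apply Cmod_ge_0.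
  apply pow_incr. split; auto. apply Cmod_ge_0.
Qed.

(** * Products and powers *)

Definition conv (a b : nat -> CC) (n : nat) : CC :=
  sum_n (fun k => a k * b (n - k)%nat)%C n.

Lemma summable2_product (x y : nat -> R) :
  ex_series x -> ex_series y -> summable2 (fun k j => x k * y j).
Proof.
  intros Hx Hy. split. intros k. apply (ex_series_scal_l (x k) y); auto.
  apply ex_series_ext with (fun k => x k * Series y).
  intros; now rewrite Series_scal_l. now apply ex_series_scal_r.
Qed.

Lemma summable2_ext (x y : nat -> nat -> R) :
  (forall k j, x k j = y k j) -> summable2 x -> summable2 y.
Proof.
  intros H [H1 H2]. split. intros n; apply ex_series_ext with (x n); auto.
  apply ex_series_ext with (fun n => Series (x n)); auto. intros; now apply Series_ext.
Qed.

Lemma sum_n_Cmult_r (u : nat -> CC) (c : CC) n :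
  (sum_n u n * c)%C = sum_n (fun k => u k * c)%C n.
Proof. symmetry. apply (sum_n_mult_r (K := C_Ring)). Qed.

Lemma sum_n_Cmult_l (u : nat -> CC) (c : CC) n :
  (c * sum_n u n)%C = sum_n (fun k => c * u k)%C n.
Proof. symmetry. apply (sum_n_mult_l (K := C_Ring)). Qed.

Lemma conv_term a b z n : (conv a b n * z ^ n)%C =
  sum_n (fun k => (a k * z ^ k) * (b (n - k)%nat * z ^ (n - k)))%C n.
Proof.
  unfold conv. rewrite sum_n_Cmult_r. apply sum_n_ext_loc. intros k Hk.
  replace (z ^ n)%C with (z ^ k * z ^ (n - k))%C by (rewrite <- Cpow_add_r; f_equal; lia).
  change (@eq CC (a k * b (n - k)%nat * (z ^ k * z ^ (n - k)))%C
    ((a k * z ^ k) * (b (n - k)%nat * z ^ (n - k)))%C). ring.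
Qed.

Lemma conv_summable2 a b z : abs_conv a (Cmod z) -> abs_conv b (Cmod z) ->
  summable2 (fun k j => Cmod ((a k * z ^ k) * (b j * z ^ j))).
Proof.
  intros Ha Hb.
  apply summable2_ext with (fun k j => Cmod (a k * z ^ k) * Cmod (b j * z ^ j)).
  intros; symmetry; apply Cmod_mult.
  apply (summable2_product (fun k => Cmod (a k * z ^ k)) (fun j => Cmod (b j * z ^ j)));
    now apply abs_conv_terms.
Qed.

Lemma abs_conv_conv a b t : 0 <= t -> abs_conv a t -> abs_conv b t -> abs_conv (conv a b) t.
Proof.
  intros Ht Ha Hb. rewrite <- (Cmod_RtoC_pos t Ht) in *.
  generalize (diag_ex_series _ (conv_summable2 a b (RtoC t) Ha Hb)).
  apply ex_series_ext. intros n. now rewrite <- conv_term, Cmod_term.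
Qed.

Lemma CSeries_scal c u : ex_series (fun n => Cmod (u n)) ->
  CSeries (fun n => c * u n)%C = (c * CSeries u)%C.
Proof. intros H. apply CSeries_unique, is_Cseries_scal. now apply CSeries_correct. Qed.

Lemma CSeries_scal_r c u : ex_series (fun n => Cmod (u n)) ->
  CSeries (fun n => u n * c)%C = (CSeries u * c)%C.
Proof.
  intros H. rewrite Cmult_comm, <- CSeries_scal; auto.
  apply CSeries_ext; intros; ring.
Qed.

Lemma PS_conv a b z : abs_conv a (Cmod z) -> abs_conv b (Cmod z) ->
  PS (conv a b) z = (PS a z * PS b z)%C.
Proof.
  intros Ha Hb. unfold PS at 1. rewrite (CSeries_ext _ _ (conv_term a b z)).
  rewrite (CSeries_unique _ _ (Cdiag_series _ (conv_summable2 a b z Ha Hb))).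
  rewrite (CSeries_ext _ (fun k => a k * z ^ k * PS b z)%C).
  - apply CSeries_scal_r. now apply abs_conv_terms.
  - intros k. apply CSeries_scal. now apply abs_conv_terms.
Qed.

Fixpoint conv_pow (a : nat -> CC) (n : nat) : nat -> CC :=
  match n with
  | O => fun k => match k with O => RtoC 1 | S _ => RtoC 0 end
  | S m => conv a (conv_pow a m)
  end.

Lemma abs_conv_conv_pow_0 a t : abs_conv (conv_pow a 0) t.
Proof.
  eexists. apply is_series_finite with (n := 0%nat). intros k Hk. destruct k. lia.
  simpl. rewrite Cmod_0. ring.
Qed.

Lemma PS_conv_pow_0 a z : PS (conv_pow a 0) z = 1.
Proof.
  rewrite (PS_incr _ z (Cmod z + 1)).
  - assert (E : PS (fun _ => RtoC 0) z = 0).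
    { apply CSeries_unique, is_Cseries_iff; simpl; split.
      1,2: apply is_series_ext with (fun _ => 0); [intros; unfold Re, Im; simpl; ring|].
      1,2: generalize (is_series_finite (fun _ => 0) 0 (fun _ _ => eq_refl)); now rewrite sum_O. }
    simpl. rewrite E. ring.
  - lra.
  - generalize (Cmod_ge_0 z); lra.
  - apply abs_conv_conv_pow_0.
Qed.

Lemma abs_conv_conv_pow a n t : 0 <= t -> abs_conv a t -> abs_conv (conv_pow a n) t.
Proof.
  intros Ht Ha. induction n.
  - apply abs_conv_conv_pow_0.
  - now apply abs_conv_conv.
Qed.

Lemma PS_conv_pow a n z : abs_conv a (Cmod z) -> PS (conv_pow a n) z = (PS a z ^ n)%C.
Proof.
  intros Ha. induction n.
  - apply PS_conv_pow_0.
  - change (PS (conv a (conv_pow a n)) z = (PS a z * PS a z ^ n)%C).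
    rewrite PS_conv, IHn; auto. apply abs_conv_conv_pow; auto. apply Cmod_ge_0.
Qed.

(** * Re-expansion about another centre *)

(** [PS (taylor a k) z] is the [k]-th Taylor coefficient at [z] of the sum of
    the series [a]; [taylor a k] are its coefficients as a power series in
    [z]. *)
Definition taylor (a : nat -> CC) (k j : nat) : CC :=
  (RtoC (Binomial.C (j + k) k) * a (j + k)%nat)%C.

Lemma binom_nonneg n k : 0 <= Binomial.C n k.
Proof.
  unfold Binomial.C. apply Rdiv_le_0_compat. apply pos_INR.
  apply Rmult_lt_0_compat; apply INR_fact_lt_0.
Qed.

Lemma binom_n_0 n : Binomial.C n 0 = 1.
Proof.
  unfold Binomial.C. rewrite Nat.sub_0_r. simpl. field. apply INR_fact_neq_0.
Qed.

Lemma binom_n_n n : Binomial.C n n = 1.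
Proof.
  unfold Binomial.C. rewrite Nat.sub_diag. simpl. field. apply INR_fact_neq_0.
Qed.

Lemma binom_S_1 n : Binomial.C (S n) 1 = INR (S n).
Proof.
  unfold Binomial.C. replace (S n - 1)%nat with n by lia.
  change (fact (S n)) with (S n * fact n)%nat. rewrite mult_INR. simpl (fact 1).
  simpl (INR 1). field. apply INR_fact_neq_0.
Qed.

Lemma sum_n_first (u : nat -> CC) n :
  sum_n u (S n) = (u 0%nat + sum_n (fun k => u (S k)) n)%C.
Proof.
  induction n.
  - now rewrite sum_Sn, !sum_O.
  - rewrite sum_Sn, IHn, (sum_Sn (fun k => u (S k))). symmetry. apply Cplus_assoc.
Qed.

Lemma Cbinomial (x y : CC) n :
  ((x + y) ^ n)%C = sum_n (fun k => RtoC (Binomial.C n k) * x ^ k * y ^ (n - k))%C n.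
Proof.
  induction n.
  - rewrite sum_O, binom_n_0. simpl. ring.
  - change ((x + y) ^ S n)%C with ((x + y) * (x + y) ^ n)%C. rewrite IHn.
    set (G := fun k => (RtoC (Binomial.C n k) * x ^ k * y ^ (n - k))%C).
    set (F := fun k => (RtoC (Binomial.C (S n) k) * x ^ k * y ^ (S n - k))%C).
    destruct n as [|m].
    + rewrite sum_Sn, !sum_O. unfold F, G. rewrite !binom_n_0, binom_n_n.
      change (((x + y) * (1 * 1 * 1))%C = (1 * 1 * (y * 1) + 1 * (x * 1) * 1)%C). ring.
    + rewrite Cmult_plus_distr_r.
      rewrite (sum_n_first F). rewrite (sum_Sn (fun k => F (S k))).
      rewrite (sum_Sn G) at 1. rewrite (sum_n_first G).
      rewrite (sum_n_ext_loc (fun k => F (S k)) (fun k => x * G k + y * G (S k))%C).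
      2:{ intros k Hk. unfold F, G. rewrite <- pascal by lia. rewrite RtoC_plus.
          replace (S (S m) - S k)%nat with (S (m - k)) by lia.
          replace (S m - k)%nat with (S (m - k)) by lia.
          replace (S m - S k)%nat with (m - k)%nat by lia.
          change (@eq CC ((RtoC (Binomial.C (S m) k) + RtoC (Binomial.C (S m) (S k))) * (x * x ^ k) * (y * y ^ (m - k)))%C
            (x * (RtoC (Binomial.C (S m) k) * x ^ k * (y * y ^ (m - k))) +
             y * (RtoC (Binomial.C (S m) (S k)) * (x * x ^ k) * y ^ (m - k)))%C). ring. }
      change (fun k => (x * G k + y * G (S k))%C)
        with (fun k => plus (x * G k)%C (y * G (S k))%C).
      rewrite sum_n_plus, <- !sum_n_Cmult_l.
      assert (E0 : F 0%nat = (y * G 0%nat)%C).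
      { unfold F, G. rewrite !binom_n_0, Nat.sub_0_r. simpl. ring. }
      assert (E1 : F (S (S m)) = (x * G (S m))%C).
      { unfold F, G. rewrite !binom_n_n, !Nat.sub_diag. simpl. ring. }
      rewrite E0, E1. unfold plus; simpl. ring.
Qed.

Definition taylor_term a (z w : CC) (k j : nat) : CC := (taylor a k j * z ^ j * w ^ k)%C.

Lemma taylor_diag a z w n :
  (a n * (z + w) ^ n)%C = sum_n (fun k => taylor_term a z w k (n - k)%nat) n.
Proof.
  rewrite (Cplus_comm z w), Cbinomial, sum_n_Cmult_l. apply sum_n_ext_loc. intros k Hk.
  unfold taylor_term, taylor. replace (n - k + k)%nat with n by lia.
  change (@eq CC (a n * (RtoC (Binomial.C n k) * w ^ k * z ^ (n - k)))%C
   (RtoC (Binomial.C n k) * a n * z ^ (n - k) * w ^ k)%C). ring.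
Qed.

Lemma Cmod_taylor_term a z w k j :
  Cmod (taylor_term a z w k j) = (Cmod (taylor a k j) * Cmod z ^ j) * Cmod w ^ k.
Proof. unfold taylor_term. now rewrite !Cmod_mult, !Cmod_pow. Qed.

Lemma Cmod_taylor a k j : Cmod (taylor a k j) = Binomial.C (j + k) k * Cmod (a (j + k)%nat).
Proof. unfold taylor. now rewrite Cmod_mult, Cmod_RtoC_pos by apply binom_nonneg. Qed.

Lemma Rbinomial (x y : R) n :
  (x + y) ^ n = sum_n (fun k => Binomial.C n k * x ^ k * y ^ (n - k)) n.
Proof. now rewrite binomial, <- sum_n_Reals. Qed.

Lemma taylor_diag_abs a z w n :
  sum_n (fun k => Cmod (taylor_term a z w k (n - k)%nat)) n =
  Cmod (a n) * (Cmod z + Cmod w) ^ n.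
Proof.
  rewrite Rplus_comm, Rbinomial.
  rewrite <- (sum_n_mult_l (K := R_Ring)).
  apply sum_n_ext_loc. intros k Hk.
  rewrite Cmod_taylor_term, Cmod_taylor. replace (n - k + k)%nat with n by lia.
  change (@eq R (Binomial.C n k * Cmod (a n) * Cmod z ^ (n - k) * Cmod w ^ k)
    (Cmod (a n) * (Binomial.C n k * Cmod w ^ k * Cmod z ^ (n - k)))). ring.
Qed.

Lemma taylor_summable2 a z w : abs_conv a (Cmod z + Cmod w) ->
  summable2 (fun k j => Cmod (taylor_term a z w k j)).
Proof.
  intros H. apply diag_summable2. intros; apply Cmod_ge_0.
  revert H. apply ex_series_ext. intros n. symmetry; apply taylor_diag_abs.
Qed.

Lemma abs_conv_taylor a k s t : 0 <= s < t -> abs_conv a t -> abs_conv (taylor a k) s.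
Proof.
  intros Hst H.
  destruct (taylor_summable2 a (RtoC s) (RtoC (t - s))) as [H1 _].
  - rewrite !Cmod_RtoC_pos by lra. now replace (s + (t - s)) with t by ring.
  - specialize (H1 k).
    assert (Hp : 0 < (t - s) ^ k) by (apply pow_lt; lra).
    apply (ex_series_scal_r (/ (t - s) ^ k)) in H1. revert H1. apply ex_series_ext. intros j.
    rewrite Cmod_taylor_term, !Cmod_RtoC_pos by lra.
    change (@eq R (Cmod (taylor a k j) * s ^ j * (t - s) ^ k * / (t - s) ^ k)
      (Cmod (taylor a k j) * s ^ j)). field. lra.
Qed.

Lemma taylor_row a z w k : abs_conv (taylor a k) (Cmod z) ->
  CSeries (taylor_term a z w k) = (PS (taylor a k) z * w ^ k)%C.
Proof.
  intros H. unfold taylor_term, PS.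
  apply (CSeries_scal_r (w ^ k)%C (fun j => taylor a k j * z ^ j)%C).
  now apply abs_conv_terms.
Qed.

(** Expand [a n * (z + w) ^ n] by the binomial theorem and collect the powers of
    [w]; the double family is absolutely summable because the sums of moduli
    along its anti-diagonals are [Cmod (a n) * (Cmod z + Cmod w) ^ n]. *)
Lemma reexpansion a z w t : Cmod z + Cmod w < t -> abs_conv a t ->
  abs_conv (fun k => PS (taylor a k) z) (Cmod w) /\
  PS (fun k => PS (taylor a k) z) w = PS a (z + w)%C.
Proof.
  intros Hzw H. assert (Hz := Cmod_ge_0 z). assert (Hw := Cmod_ge_0 w).
  assert (S2 : summable2 (fun k j => Cmod (taylor_term a z w k j))).
  { apply taylor_summable2. apply abs_conv_le with t; auto; lra. }
  assert (Hk : forall k, abs_conv (taylor a k) (Cmod z)).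
  { intros k. apply abs_conv_taylor with t; auto; lra. }
  assert (R1 : forall k, CSeries (taylor_term a z w k) = (PS (taylor a k) z * w ^ k)%C).
  { intros k. now apply taylor_row. }
  split.
  - destruct S2 as [S2 S3]. revert S3. apply ex_series_le_pos. intros k. split.
    apply Rmult_le_pos. apply Cmod_ge_0. now apply pow_le.
    rewrite <- Cmod_term, <- R1. apply Cmod_CSeries_le. apply S2.
  - unfold PS at 1. rewrite <- (CSeries_ext _ _ R1).
    rewrite <- (CSeries_unique _ _ (Cdiag_series _ S2)).
    apply CSeries_ext. intros n; symmetry; apply taylor_diag.
Qed.

(** The bound does not depend on [z] or [k]; this uniformity is what the
    compactness argument needs. *)
Lemma taylor_coef_bound a z d t k : 0 < d -> Cmod z + d <= t -> abs_conv a t ->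
  Cmod (PS (taylor a k) z) * d ^ k <= Series (fun n => Cmod (a n) * t ^ n).
Proof.
  intros Hd Ht H. assert (Hz := Cmod_ge_0 z).
  assert (H' : abs_conv a (Cmod z + Cmod (RtoC d))).
  { apply abs_conv_le with t; auto. rewrite Cmod_RtoC_pos; lra. }
  assert (S2 := taylor_summable2 a z (RtoC d) H').
  assert (Hr : forall k, Cmod (PS (taylor a k) z) * d ^ k <=
                 Series (fun j => Cmod (taylor_term a z (RtoC d) k j))).
  { intros i. replace (Cmod _ * d ^ i) with (Cmod (PS (taylor a i) z * RtoC d ^ i)).
    2:{ rewrite Cmod_term, Cmod_RtoC_pos; lra. }
    rewrite <- taylor_row. apply Cmod_CSeries_le, S2.
    apply abs_conv_taylor with t; auto; lra. }
  apply Rle_trans with (1 := Hr k).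
  apply Rle_trans with (1 := term_le_Series (fun k => Series (fun j => Cmod (taylor_term a z (RtoC d) k j))) k
    (fun k => Series_nonneg _ (fun j => Cmod_ge_0 _) (proj1 S2 k)) (proj2 S2)).
  rewrite <- (is_series_unique _ _ (diag_series _ _ (fun k j => Req_le _ _ (Rabs_pos_eq _ (Cmod_ge_0 (taylor_term a z (RtoC d) k j)))) S2)).
  rewrite (Series_ext _ _ (taylor_diag_abs a z (RtoC d))).
  apply Series_le; auto. rewrite Cmod_RtoC_pos by lra.
  intros n; split.
  - apply Rmult_le_pos. apply Cmod_ge_0. apply pow_le; lra.
  - apply Rmult_le_compat_l. apply Cmod_ge_0. apply pow_incr; lra.
Qed.

(** * Roots of unity *)

Definition cis (t : R) : CC := (cos t, sin t).

Lemma Cmod_cis t : Cmod (cis t) = 1.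
Proof.
  unfold Cmod, cis; simpl. rewrite !Rmult_1_r.
  rewrite <- sqrt_1. f_equal. rewrite Rplus_comm. apply sin2_cos2.
Qed.

Lemma cis_pow t n : (cis t ^ n)%C = cis (INR n * t).
Proof.
  induction n.
  - simpl. unfold cis. now rewrite Rmult_0_l, cos_0, sin_0.
  - rewrite Cpow_S, IHn, S_INR. unfold cis.
    replace ((INR n + 1) * t) with (t + INR n * t) by ring.
    rewrite cos_plus, sin_plus. unfold Cmult; simpl. f_equal; ring.
Qed.

Lemma geom_sum (x : CC) n : ((x - 1) * sum_n (fun j => x ^ j) n)%C = (x ^ S n - 1)%C.
Proof.
  induction n.
  - rewrite sum_O. simpl. ring.
  - rewrite sum_Sn. change (plus ?a ?b) with (Cplus a b).
    rewrite Cmult_plus_distr_l, IHn. rewrite (Cpow_S x (S n)). ring.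
Qed.

(** [cos t = 1 - 2 sin^2 (t / 2)], and [sin] is positive on ]0, pi[. *)
Lemma cis_neq_1 t : 0 < t < 2 * PI -> cis t <> 1.
Proof.
  intros Ht E. apply (f_equal Re) in E. simpl in E.
  replace t with (2 * (t / 2)) in E by field.
  rewrite cos_2a_sin in E.
  assert (H : 0 < sin (t / 2)) by (apply sin_gt_0; lra). nra.
Qed.

(** The order is [S p], since [sum_n _ p] has [S p] terms. *)
Definition unity_root (p : nat) : CC := cis (2 * PI / INR (S p)).

Lemma unity_root_period p m : (unity_root p ^ (m * S p))%C = 1.
Proof.
  unfold unity_root. rewrite cis_pow, mult_INR.
  replace (INR m * INR (S p) * (2 * PI / INR (S p))) with (0 + 2 * INR m * PI)
    by (field; apply not_0_INR; lia).
  unfold cis. rewrite cos_period, sin_period, cos_0, sin_0. reflexivity.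
Qed.

Lemma sum_powers_unity_root p m : (0 < m < S p)%nat ->
  sum_n (fun j => (unity_root p ^ m) ^ j)%C p = RtoC 0.
Proof.
  intros Hm.
  assert (N : (unity_root p ^ m)%C <> 1).
  { unfold unity_root. rewrite cis_pow. apply cis_neq_1.
    assert (H1 : 0 < INR m) by (apply lt_0_INR; lia).
    assert (H2 : INR m < INR (S p)) by (apply lt_INR; lia).
    generalize PI_RGT_0; intros HPI. split.
    - apply Rmult_lt_0_compat; auto. apply Rdiv_lt_0_compat; lra.
    - replace (INR m * (2 * PI / INR (S p))) with (2 * PI * (INR m / INR (S p))) by (field; lra).
      rewrite <- (Rmult_1_r (2 * PI)) at 2. apply Rmult_lt_compat_l. lra.
      apply Rmult_lt_reg_r with (INR (S p)). lra. field_simplify; lra. }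
  assert (G := geom_sum (unity_root p ^ m)%C p).
  rewrite <- Cpow_mult_r in G. rewrite unity_root_period in G.
  replace (1 - 1)%C with (RtoC 0) in G by ring.
  destruct (Ceq_dec (sum_n (fun j => ((unity_root p ^ m) ^ j)%C) p) 0) as [E|E]; auto.
  exfalso. refine (Cmult_neq_0 _ _ _ E G).
  intros E'. apply N. apply (f_equal (fun x => x + 1)%C) in E'.
  ring_simplify in E'. exact E'.
Qed.

Lemma Cconj_sum_n (u : nat -> CC) n : Cconj (sum_n u n) = sum_n (fun k => Cconj (u k)) n.
Proof.
  induction n. now rewrite !sum_O.
  rewrite !sum_Sn, <- IHn. apply (Cplus_conj (sum_n u n) (u (S n))).
Qed.

Lemma sum_n_Cconst (c : CC) n : sum_n (fun _ => c) n = (RtoC (INR (S n)) * c)%C.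
Proof.
  induction n.
  - rewrite sum_O. simpl. symmetry; apply Cmult_1_l.
  - rewrite sum_Sn, IHn, (S_INR (S n)), RtoC_plus. change (plus ?a ?b) with (Cplus a b).
    C_eq. ring.
Qed.

Lemma unit_conj (x : CC) : Cmod x = 1 -> (x * Cconj x)%C = 1.
Proof. intros H. rewrite <- Cmod2_conj, H. f_equal. ring. Qed.

Lemma Cmod_unity_root_pow p a j : Cmod ((unity_root p ^ a) ^ j)%C = 1.
Proof. unfold unity_root. now rewrite !Cmod_pow, Cmod_cis, !pow1. Qed.

Lemma unity_root_orthogonal p a b : (a <= p)%nat -> (b <= p)%nat ->
  sum_n (fun j => (unity_root p ^ a) ^ j * Cconj ((unity_root p ^ b) ^ j))%C p =
  if Nat.eqb a b then RtoC (INR (S p)) else RtoC 0.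
Proof.
  intros Ha Hb. destruct (Nat.eqb_spec a b) as [->|Hab].
  - rewrite (sum_n_ext _ (fun _ => RtoC 1)). rewrite sum_n_Cconst. apply Cmult_1_r.
    intros j. apply unit_conj, Cmod_unity_root_pow.
  - assert (D : forall c d, (c < d <= p)%nat -> sum_n (fun j => (unity_root p ^ d) ^ j * Cconj ((unity_root p ^ c) ^ j))%C p = RtoC 0).
    { intros c d Hcd. rewrite <- (sum_powers_unity_root p (d - c)) by lia.
      apply sum_n_ext. intros j. replace d with (d - c + c)%nat at 1 by lia.
      rewrite Cpow_add_r, Cpow_mult_l.
      rewrite <- (Cmult_1_r ((unity_root p ^ (d - c)) ^ j)%C) at 2.
      rewrite <- (unit_conj _ (Cmod_unity_root_pow p c j)).
      symmetry; apply Cmult_assoc. }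
    destruct (Nat.lt_ge_cases b a) as [L|L].
    + apply D; lia.
    + rewrite <- (Cconj_conj (sum_n _ p)), Cconj_sum_n.
      rewrite (sum_n_ext _ (fun j => (unity_root p ^ b) ^ j * Cconj ((unity_root p ^ a) ^ j))%C).
      rewrite D by lia. apply injective_projections; simpl; ring.
      intros j. rewrite Cmult_conj, Cconj_conj. apply Cmult_comm.
Qed.

Definition partial_sum (c : nat -> CC) (K : nat) (z : CC) : CC := sum_n (fun k => c k * z ^ k)%C K.

(** Orthogonality of characters extracts one coefficient of a polynomial from
    its values at equally spaced points of a circle.  The shift [d] also covers
    the pairing with non-conjugated characters, where all terms vanish. *)
Lemma unity_root_projection (c : nat -> CC) K (x : CC) p d b : (K + d <= p)%nat -> (b <= p)%nat ->
  sum_n (fun j => partial_sum c K (x * unity_root p ^ j) * ((unity_root p ^ d) ^ j * Cconj ((unity_root p ^ b) ^ j)))%C p =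
  (RtoC (INR (S p)) * sum_n (fun k => if Nat.eqb (k + d) b then c k * x ^ k else RtoC 0)%C K)%C.
Proof.
  intros HK Hb. unfold partial_sum.
  rewrite (sum_n_ext _ (fun j => sum_n (fun k =>
    (c k * x ^ k) * ((unity_root p ^ (k + d)) ^ j * Cconj ((unity_root p ^ b) ^ j)))%C K)).
  - rewrite sum_n_switch, sum_n_Cmult_l. apply sum_n_ext_loc. intros k Hk.
    rewrite <- sum_n_Cmult_l. rewrite unity_root_orthogonal by lia.
    destruct (Nat.eqb (k + d) b).
    apply Cmult_comm. rewrite !Cmult_0_r. reflexivity.
  - intros j. rewrite sum_n_Cmult_r. apply sum_n_ext. intros k.
    rewrite Cpow_mult_l, Cpow_add_r, Cpow_mult_l, <- !Cpow_mult_r, (Nat.mul_comm j k).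
    C_eq. ring.
Qed.

Lemma sum_n_pick (c : nat -> CC) K b :
  (b <= K)%nat -> sum_n (fun k => if Nat.eqb k b then c k else RtoC 0) K = c b.
Proof.
  assert (Z : forall K, (K < b)%nat -> sum_n (fun k => if Nat.eqb k b then c k else RtoC 0) K = RtoC 0).
  { intros L. induction L; intros H.
    - rewrite sum_O. destruct (Nat.eqb_spec 0 b); auto. lia.
    - rewrite sum_Sn, IHL by lia. destruct (Nat.eqb_spec (S L) b). lia. apply Cplus_0_r. }
  induction K; intros H.
  - rewrite sum_O. assert (b = 0)%nat by lia. subst. reflexivity.
  - rewrite sum_Sn. destruct (Nat.eqb_spec (S K) b) as [E|N].
    + rewrite Z, E by lia. apply Cplus_0_l.
    + rewrite IHK by lia. apply Cplus_0_r.
Qed.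

Lemma sum_n_zero K : sum_n (fun _ : nat => RtoC 0) K = RtoC 0.
Proof. rewrite sum_n_Cconst. apply Cmult_0_r. Qed.

Lemma rotate_to_real (z : CC) : exists u, Cmod u = 1 /\ (u * z)%C = RtoC (Cmod z).
Proof.
  destruct (Ceq_dec z 0) as [->|N].
  - exists 1. split. apply Cmod_1. rewrite Cmod_0. ring.
  - exists (Cconj z / RtoC (Cmod z))%C.
    assert (H : 0 < Cmod z) by now apply Cmod_gt_0.
    assert (H' : RtoC (Cmod z) <> 0) by (intros E; apply RtoC_inj in E; lra).
    split.
    + rewrite Cmod_div, Cmod_conj, Cmod_RtoC_pos; auto; try lra. field. lra.
    + replace (Cconj z / RtoC (Cmod z) * z)%C with ((z * Cconj z) / RtoC (Cmod z))%C by (field; auto).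
      rewrite <- Cmod2_conj. simpl. rewrite Rmult_1_r, RtoC_mult. field. auto.
Qed.

(** * Coefficient estimates *)

(** Rotate so that the constant term is nonnegative: [u * c 0 = |c 0|].  The
    numbers [q j = M - Re (u * P j)] are nonnegative with mean [M - |c 0|], and
    their pairing with the conjugate of the [n]-th character has mean
    [- u * c n * s ^ n / 2]: of [Re (u * P)], only the half [u * P / 2]
    contributes, the conjugate half being orthogonal to that character. *)
Lemma caratheodory_poly (c : nat -> CC) K s M n : 0 <= s -> (1 <= n <= K)%nat ->
  (forall z, Cmod z = s -> Cmod (partial_sum c K z) <= M) ->
  Cmod (c n) * s ^ n <= 2 * (M - Cmod (c 0%nat)).
Proof.
  intros Hs Hn HM.
  destruct (rotate_to_real (c 0%nat)) as [u [Hu Hu0]].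
  (* More points than [K + n], so that no two of the exponents involved agree
     modulo their number. *)
  set (p := (K + n)%nat). set (N := RtoC (INR (S p))).
  set (P := fun j => partial_sum c K (RtoC s * unity_root p ^ j)%C).
  set (W := fun j => Cconj ((unity_root p ^ n) ^ j)%C).
  assert (HN : 0 < INR (S p)) by (apply lt_0_INR; lia).
  assert (A0 : sum_n P p = (N * c 0%nat)%C).
  { rewrite (sum_n_ext _ (fun j => partial_sum c K (RtoC s * unity_root p ^ j) * ((unity_root p ^ 0) ^ j * Cconj ((unity_root p ^ 0) ^ j)))%C).
    - rewrite unity_root_projection by lia. unfold N. f_equal.
      rewrite (sum_n_ext _ (fun k => if Nat.eqb k 0 then c k * RtoC s ^ k else RtoC 0)%C)
        by (intros k; now rewrite Nat.add_0_r).
      rewrite (sum_n_pick (fun k => c k * RtoC s ^ k)%C) by lia. apply Cmult_1_r.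
    - intros j. rewrite (unit_conj _ (Cmod_unity_root_pow p 0 j)). symmetry; apply Cmult_1_r. }
  assert (A1 : sum_n (fun j => P j * Cconj (W j))%C p = RtoC 0).
  { rewrite (sum_n_ext _ (fun j => partial_sum c K (RtoC s * unity_root p ^ j) * ((unity_root p ^ n) ^ j * Cconj ((unity_root p ^ 0) ^ j)))%C).
    - rewrite unity_root_projection by lia.
      rewrite (sum_n_ext _ (fun _ => RtoC 0)). rewrite sum_n_zero. apply Cmult_0_r.
      intros k. destruct (Nat.eqb_spec (k + n) 0); auto. lia.
    - intros j. unfold W. rewrite Cconj_conj, Cpow_1_l.
      replace (Cconj 1) with (RtoC 1). now rewrite Cmult_1_r.
      apply injective_projections; simpl; ring. }
  assert (A2 : sum_n (fun j => P j * W j)%C p = (N * (c n * RtoC s ^ n))%C).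
  { rewrite (sum_n_ext _ (fun j => partial_sum c K (RtoC s * unity_root p ^ j) * ((unity_root p ^ 0) ^ j * Cconj ((unity_root p ^ n) ^ j)))%C).
    - rewrite unity_root_projection by lia. unfold N. f_equal.
      rewrite (sum_n_ext _ (fun k => if Nat.eqb k n then c k * RtoC s ^ k else RtoC 0)%C)
        by (intros k; now rewrite Nat.add_0_r).
      apply (sum_n_pick (fun k => c k * RtoC s ^ k)%C). lia.
    - intros j. simpl. rewrite Cpow_1_l, Cmult_1_l. reflexivity. }
  assert (A3 : sum_n W p = RtoC 0).
  { rewrite (sum_n_ext _ (fun j => (unity_root p ^ 0) ^ j * Cconj ((unity_root p ^ n) ^ j))%C).
    rewrite unity_root_orthogonal by lia. destruct (Nat.eqb_spec 0 n); auto; lia.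
    intros j. simpl. rewrite Cpow_1_l, Cmult_1_l. reflexivity. }
  set (q := fun j => M - Re (u * P j)).
  assert (Hq : forall j, 0 <= q j).
  { intros j. unfold q. apply Rge_le, Rge_minus, Rle_ge.
    apply Rle_trans with (1 := Rle_abs _). apply Rle_trans with (1 := re_le_Cmod _).
    rewrite Cmod_mult, Hu, Rmult_1_l. apply HM.
    rewrite Cmod_mult, Cmod_pow. unfold unity_root. rewrite Cmod_cis, pow1, Cmod_RtoC_pos; lra. }
  assert (Sq : sum_n q p = INR (S p) * (M - Cmod (c 0%nat))).
  { transitivity (Re (sum_n (fun j => plus (RtoC M) (- u * P j)%C) p)).
    - rewrite Re_sum_n. apply sum_n_ext. intros j. unfold q, Re; simpl. R_eq. ring.
    - rewrite sum_n_plus, sum_n_Cconst, <- sum_n_Cmult_l, A0. unfold N.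
      change (plus ?a ?b) with (Cplus a b).
      replace (- u * (RtoC (INR (S p)) * c 0%nat))%C with (- (RtoC (INR (S p)) * (u * c 0%nat)))%C by ring.
      rewrite Hu0, <- !RtoC_mult, <- RtoC_opp, <- RtoC_plus.
      change (INR (S p) * M + - (INR (S p) * Cmod (c 0%nat)) = INR (S p) * (M - Cmod (c 0%nat))). ring. }
  assert (SW : sum_n (fun j => RtoC (q j) * W j)%C p = (- / 2 * N * (u * (c n * RtoC s ^ n)))%C).
  { rewrite (sum_n_ext _ (fun j => plus (plus (RtoC M * W j)%C (- / 2 * u * (P j * W j))%C)
        (- / 2 * Cconj u * Cconj (P j * Cconj (W j)))%C)).
    - rewrite !sum_n_plus, <- !sum_n_Cmult_l, <- Cconj_sum_n, A1, A2, A3.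
      change (plus ?a ?b) with (Cplus a b).
      replace (Cconj 0) with (RtoC 0) by (apply injective_projections; simpl; ring). C_eq; ring.
    - intros j. unfold q. rewrite RtoC_minus, re_alt.
      rewrite !Cmult_conj, Cconj_conj. change (plus ?a ?b) with (Cplus a b).
      C_eq. field. }
  assert (B : Cmod (sum_n (fun j => RtoC (q j) * W j)%C p) <= sum_n q p).
  { apply Rle_trans with (1 := Cmod_sum_n _ _). apply sum_n_le_loc. intros j _.
    rewrite Cmod_mult, Cmod_RtoC_pos by auto. unfold W. rewrite Cmod_conj, Cmod_unity_root_pow. lra. }
  rewrite SW, Sq in B. unfold N in B.
  replace (- / 2 * RtoC (INR (S p)) * (u * (c n * RtoC s ^ n)))%C
    with (RtoC (- / 2 * INR (S p)) * (u * (c n * RtoC s ^ n)))%C in B.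
  2:{ rewrite RtoC_mult, RtoC_opp, RtoC_inv. reflexivity. lra. }
  rewrite !Cmod_mult, Hu, Cmod_pow, (Cmod_RtoC_pos s), Rmult_1_l in B by auto.
  rewrite Cmod_R, Rabs_mult, Rabs_Ropp, !Rabs_pos_eq in B by lra.
  apply Rmult_le_reg_l with (/ 2 * INR (S p)). lra. lra.
Qed.

Lemma PS_uniform_approx c s eps : 0 <= s -> abs_conv c s -> 0 < eps ->
  exists K0, forall K, (K0 <= K)%nat -> forall z, Cmod z = s ->
    Cmod (PS c z - partial_sum c K z) <= eps.
Proof.
  intros Hs H He.
  assert (L : is_lim_seq (sum_n (fun n => Cmod (c n) * s ^ n)) (Series (fun n => Cmod (c n) * s ^ n)))
    by exact (Series_correct _ H).
  apply is_lim_seq_spec in L. destruct (L (mkposreal eps He)) as [K0 HK].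
  exists K0. intros K HK0 z Hz. specialize (HK K HK0). simpl in HK.
  set (b := fun n => Cmod (c n) * s ^ n) in *.
  assert (Hb : forall n, 0 <= b n).
  { intros n. apply Rmult_le_pos. apply Cmod_ge_0. now apply pow_le. }
  assert (T : is_series (fun n => b (S K + n)%nat) (Series b - sum_n b K)).
  { apply is_series_incr_n. lia.
    replace (plus _ _) with (Series b). now apply Series_correct.
    change (Series b = Series b - sum_n b K + sum_n b K). ring. }
  apply Cmod_series_le with (fun n => (c (S K + n)%nat * z ^ (S K + n))%C).
  - apply (@is_series_incr_n C_AbsRing C_NormedModule (fun n => c n * z ^ n)%C). lia.
    replace (plus _ _) with (PS c z). apply PS_correct. now rewrite Hz.
    change (PS c z = (PS c z - partial_sum c K z) + partial_sum c K z)%C. ring.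
  - intros m. apply Rle_trans with (1 := Cmod_sum_n _ _).
    rewrite (sum_n_ext _ (fun n => b (S K + n)%nat)).
    2:{ intros n. unfold b. now rewrite Cmod_term, Hz. }
    apply Rle_trans with (Series (fun n => b (S K + n)%nat)).
    apply (sum_n_le_Series (fun n => b (S K + n)%nat)); auto. eexists; exact T.
    rewrite (is_series_unique _ _ T).
    apply Rle_trans with (1 := Rle_abs _). rewrite Rabs_minus_sym. now apply Rlt_le.
Qed.

(** The partial sums are bounded by [M + eps / 2] on the circle once their degree
    is large. *)
Lemma caratheodory (c : nat -> CC) s M n : 0 <= s -> (1 <= n)%nat -> abs_conv c s ->
  (forall z, Cmod z = s -> Cmod (PS c z) <= M) ->
  Cmod (c n) * s ^ n <= 2 * (M - Cmod (c 0%nat)).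
Proof.
  intros Hs Hn Hc HM. apply le_epsilon. intros eps He.
  destruct (PS_uniform_approx c s (eps / 2) Hs Hc) as [K0 HK]. lra.
  replace (2 * (M - Cmod (c 0%nat)) + eps) with (2 * ((M + eps / 2) - Cmod (c 0%nat))) by field.
  apply caratheodory_poly with (K0 + n)%nat; auto. lia.
  intros z Hz.
  replace (partial_sum c (K0 + n) z) with (PS c z - (PS c z - partial_sum c (K0 + n) z))%C by ring.
  apply Rle_trans with (1 := Cmod_triangle _ _). rewrite Cmod_opp.
  apply Rplus_le_compat. now apply HM. apply HK; auto. lia.
Qed.

(** A Cauchy estimate with the constant 2.  For [n = 0] it follows from
    nonnegativity of the left-hand side in [caratheodory]. *)
Lemma coef_bound (c : nat -> CC) s M n : 0 <= s -> abs_conv c s ->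
  (forall z, Cmod z = s -> Cmod (PS c z) <= M) -> Cmod (c n) * s ^ n <= 2 * M.
Proof.
  intros Hs Hc HM.
  assert (H0 := Cmod_ge_0 (c 0%nat)).
  destruct n as [|n].
  - assert (H := caratheodory c s M 1 Hs (le_n _) Hc HM).
    assert (0 <= Cmod (c 1%nat) * s ^ 1) by (apply Rmult_le_pos; [apply Cmod_ge_0|now apply pow_le]).
    simpl in *. lra.
  - assert (H := caratheodory c s M (S n) Hs (le_n_S _ _ (Nat.le_0_l n)) Hc HM). lra.
Qed.

Lemma PS_minus a b z : abs_conv a (Cmod z) -> abs_conv b (Cmod z) ->
  PS (fun n => a n - b n)%C z = (PS a z - PS b z)%C.
Proof.
  intros Ha Hb. apply CSeries_unique.
  assert (H := is_Cseries_plus _ _ _ _ (PS_correct a z Ha) (is_Cseries_scal (-(1))%C _ _ (PS_correct b z Hb))).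
  replace (PS a z - PS b z)%C with (PS a z + -(1) * PS b z)%C by ring.
  revert H. apply (@is_series_ext C_AbsRing C_NormedModule). intros n. C_eq. ring.
Qed.

Lemma abs_conv_minus a b t : 0 <= t -> abs_conv a t -> abs_conv b t ->
  abs_conv (fun n => a n - b n)%C t.
Proof.
  intros Ht Ha Hb.
  apply ex_series_le_pos with (fun n => Cmod (a n) * t ^ n + Cmod (b n) * t ^ n).
  - intros n. split. apply Rmult_le_pos. apply Cmod_ge_0. now apply pow_le.
    rewrite <- Rmult_plus_distr_r. apply Rmult_le_compat_r. now apply pow_le.
    rewrite <- (Cmod_opp (b n)). apply Cmod_triangle.
  - apply (ex_series_plus _ _ Ha Hb).
Qed.

(** The difference of the two series is bounded by 0 on the circle. *)
Lemma coefs_unique a b t : 0 < t -> abs_conv a t -> abs_conv b t ->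
  (forall z, Cmod z = t -> PS a z = PS b z) -> forall n, a n = b n.
Proof.
  intros Ht Ha Hb E n.
  assert (H := coef_bound (fun n => a n - b n)%C t 0 n (Rlt_le _ _ Ht)
    (abs_conv_minus a b t (Rlt_le _ _ Ht) Ha Hb)).
  assert (H' : Cmod (a n - b n) * t ^ n <= 2 * 0).
  { apply H. intros z Hz. rewrite PS_minus, E by (rewrite ?Hz; auto).
    replace (PS b z - PS b z)%C with (RtoC 0) by ring. rewrite Cmod_0; lra. }
  assert (Hp := pow_lt t n Ht). assert (H0 := Cmod_ge_0 (a n - b n)).
  apply Ceq_minus. apply Cmod_eq_0. nra.
Qed.

Lemma pseries_unique a b g rho : 0 < rho ->
  (forall z, Cmod z < rho -> @is_pseries C_AbsRing C_NormedModule a z (g z)) ->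
  (forall z, Cmod z < rho -> @is_pseries C_AbsRing C_NormedModule b z (g z)) ->
  forall n, a n = b n.
Proof.
  intros Hr Ha Hb. apply coefs_unique with (rho / 2). lra.
  - apply pseries_abs_conv with g rho; auto; lra.
  - apply pseries_abs_conv with g rho; auto; lra.
  - intros z Hz. rewrite (PS_unique _ _ _ (Ha z ltac:(lra))), (PS_unique _ _ _ (Hb z ltac:(lra))). reflexivity.
Qed.

(** * Expansion on the whole disc *)

Definition has_ps (g : CC -> CC) (z0 : CC) (a : nat -> CC) (rho : R) : Prop :=
  forall w, Cmod w < rho -> @is_pseries C_AbsRing C_NormedModule a w (g (z0 + w)%C).

Lemma has_ps_abs_conv g z0 a rho t : has_ps g z0 a rho -> 0 <= t < rho -> abs_conv a t.
Proof. intros H. apply pseries_abs_conv with (1 := H). Qed.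

Lemma is_pseries_PS a z t : Cmod z <= t -> abs_conv a t ->
  @is_pseries C_AbsRing C_NormedModule a z (PS a z).
Proof.
  intros Hz Ha. apply is_pseries_Cseries, PS_correct. apply abs_conv_le with t; auto.
  split; auto. apply Cmod_ge_0.
Qed.

Lemma has_ps_reexpand g z0 a rho d : has_ps g z0 a rho -> Cmod d < rho ->
  has_ps g (z0 + d)%C (fun k => PS (taylor a k) d) (rho - Cmod d).
Proof.
  intros H Hd w Hw. assert (D := Cmod_ge_0 d). assert (W := Cmod_ge_0 w).
  set (t := (Cmod d + Cmod w + rho) / 2).
  destruct (reexpansion a d w t) as [R1 R2]. unfold t; lra.
  apply has_ps_abs_conv with (1 := H). unfold t; lra.
  replace (g (z0 + d + w)%C) with (PS (fun k => PS (taylor a k) d) w).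
  - apply is_pseries_PS with (2 := R1). lra.
  - rewrite R2. rewrite <- Cplus_assoc. apply PS_unique, H.
    apply Rle_lt_trans with (1 := Cmod_triangle _ _). lra.
Qed.

Lemma analytic_has_ps g z0 : analytic_in_disc g -> in_disc z0 ->
  exists a rho, 0 < rho /\ has_ps g z0 a rho.
Proof.
  intros H Hz. destruct (H z0 Hz) as (a & rho & Hr & Ha). exists a, rho. split; auto.
  intros w Hw. specialize (Ha (z0 + w)%C). replace (z0 + w - z0)%C with w in Ha by ring. auto.
Qed.

(** A quantitative form of analyticity at [z0] in which a single number serves
    as radius and, through its inverse, as bound on the coefficients.  Hence it
    is inherited by smaller [d], as [tame_uniformly] requires. *)
Definition tame_at (g : CC -> CC) (z0 : CC) (d : R) : Prop :=
  exists b, has_ps g z0 b d /\ forall k, Cmod (b k) * d ^ k <= / d.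

Lemma tame_at_mono g z0 d d' : 0 < d' <= d -> tame_at g z0 d -> tame_at g z0 d'.
Proof.
  intros Hd (b & Hb & B). exists b. split.
  - intros w Hw. apply Hb. lra.
  - intros k. apply Rle_trans with (Cmod (b k) * d ^ k).
    apply Rmult_le_compat_l. apply Cmod_ge_0. apply pow_incr; lra.
    apply Rle_trans with (1 := B k). apply Rinv_le_contravar; lra.
Qed.

(** All points near [t0] share the value of [d], because
    [taylor_coef_bound] is uniform in the new centre. *)
Lemma tame_nearby g t0 a rho : 0 < rho -> has_ps g t0 a rho ->
  exists d, 0 < d /\ forall z0, Cmod (z0 - t0) < 2 * d -> tame_at g z0 d.
Proof.
  intros Hr H.
  assert (Ha : abs_conv a (rho / 2)) by (apply has_ps_abs_conv with (1 := H); lra).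
  set (A := Series (fun n => Cmod (a n) * (rho / 2) ^ n)).
  assert (HA : 0 <= A).
  { apply Series_nonneg; auto. intros n. apply Rmult_le_pos. apply Cmod_ge_0. apply pow_le; lra. }
  (* A new centre within [2 d] of [t0] and a radius [d] add up to at most
     [rho / 2], where the coefficient sum is [A]. *)
  set (d := Rmin (rho / 6) (/ (A + 1))).
  assert (Hd1 : d <= rho / 6) by apply Rmin_l.
  assert (Hd2 : d <= / (A + 1)) by apply Rmin_r.
  assert (Hi : 0 < / (A + 1)) by (apply Rinv_0_lt_compat; lra).
  assert (Hd : 0 < d) by (apply Rmin_glb_lt; lra).
  assert (HAd : A <= / d).
  { apply Rle_trans with (A + 1). lra. rewrite <- (Rinv_inv (A + 1)).
    apply Rinv_le_contravar; auto. }
  exists d. split; auto. intros z0 Hz.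
  exists (fun k => PS (taylor a k) (z0 - t0)%C). split.
  - intros w Hw. replace (z0 + w)%C with (t0 + (z0 - t0) + w)%C by ring.
    apply (has_ps_reexpand g t0 a rho (z0 - t0)%C H). lra. lra.
  - intros k. apply Rle_trans with (2 := HAd). apply taylor_coef_bound; auto. lra.
Qed.

(** Compactness of the square around the closed disc of radius [rho].  At a
    point of the square outside the open unit disc the condition is made vacuous
    by a neighbourhood that avoids the closed disc of radius [rho]. *)
Lemma tame_uniformly g rho : analytic_in_disc g -> rho < 1 ->
  exists d, 0 < d /\ forall z0, Cmod z0 <= rho -> tame_at g z0 d.
Proof.
  intros Hg Hr.
  assert (L : forall t0 : CC, exists d : posreal, forall z0, Cmod z0 <= rho ->
     Cmod (z0 - t0) < 2 * d -> tame_at g z0 d).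
  { intros t0. destruct (Rlt_dec (Cmod t0) 1) as [Ht|Ht].
    - destruct (analytic_has_ps g t0 Hg Ht) as (a & r & Hr0 & Ha).
      destruct (tame_nearby g t0 a r Hr0 Ha) as (d & Hd & G).
      exists (mkposreal d Hd). intros; now apply G.
    - assert (Hp : 0 < (1 - rho) / 2) by lra.
      exists (mkposreal _ Hp). simpl. intros z0 Hz Hd. exfalso. apply Ht.
      replace t0 with (z0 + - (z0 - t0))%C by ring.
      apply Rle_lt_trans with (1 := Cmod_triangle _ _). rewrite Cmod_opp. lra. }
  set (delta := fun u v => proj1_sig (constructive_indefinite_description _ (L (u, v)))).
  destruct (compactness_value_2d (-1) 1 (-1) 1 delta) as [d Hd].
  exists d. split. apply cond_pos. intros z0 Hz.
  apply NNPP. intros N.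
  assert (B1 := Rle_trans _ _ _ (re_le_Cmod z0) Hz).
  assert (B2 := Rle_trans _ _ _ (im_le_Cmod z0) Hz).
  apply Rabs_le_between in B1. apply Rabs_le_between in B2.
  apply (Hd (Re z0) (Im z0)); try lra. intros (u & v & Hu & Hv & H1 & H2 & H3). apply N.
  unfold delta in *. destruct (constructive_indefinite_description _ (L (u, v))) as [e He]. simpl in *.
  apply tame_at_mono with e. split; auto. apply cond_pos. apply He; auto.
  apply Rle_lt_trans with (1 := Cmod_2Rmax _). simpl.
  assert (S2 : sqrt 2 <= 2).
  { rewrite <- (sqrt_square 2) at 2 by lra. apply sqrt_le_1_alt. lra. }
  assert (M : Rmax (Rabs (fst z0 + - u)) (Rabs (snd z0 + - v)) < e) by (apply Rmax_lub_lt; assumption).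
  assert (0 <= Rmax (Rabs (fst z0 + - u)) (Rabs (snd z0 + - v))).
  { apply Rle_trans with (2 := Rmax_l _ _). apply Rabs_pos. }
  nra.
Qed.

Lemma sum_half_le n : sum_n (fun k => (/ 2) ^ k) n <= 2.
Proof.
  apply Rle_trans with (/ (1 - / 2)); [|lra].
  rewrite <- (Series_geom (/ 2)) by (rewrite Rabs_pos_eq; lra).
  apply (sum_n_le_Series (fun k => (/ 2) ^ k)).
  intros; apply pow_le; lra. apply ex_series_geom. rewrite Rabs_pos_eq; lra.
Qed.

(** For [z0] inside the disc of radius [rho] the tame local series is the
    re-expansion of [c], so [z0 |-> PS (taylor c k) z0] is bounded by
    [/ d / d ^ k].  Its coefficients [C(j + k, k) c_(j + k)] are bounded by
    [coef_bound] on a circle of radius [s] close to [rho], and the binomial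
    theorem turns this into a bound of [|c_n| (s + d / 2) ^ n]. *)
Lemma extension_step g c rho : analytic_in_disc g -> 0 < rho < 1 -> has_ps g 0 c rho ->
  exists rho', rho < rho' /\ has_ps g 0 c rho'.
Proof.
  intros Hg Hr Hc.
  destruct (tame_uniformly g rho Hg) as (d0 & Hd0 & G0). lra.
  set (d := Rmin d0 rho).
  assert (Hd : 0 < d) by (apply Rmin_glb_lt; lra).
  assert (Hdr : d <= rho) by apply Rmin_r.
  assert (Key : forall z0, Cmod z0 < rho ->
    has_ps g z0 (fun k => PS (taylor c k) z0) d /\
    forall k, Cmod (PS (taylor c k) z0) * d ^ k <= / d).
  { intros z0 Hz. destruct (tame_at_mono g z0 d0 d) as (b & Hb & B).
    split; auto. apply Rmin_l. apply G0; lra.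
    assert (Hb' := has_ps_reexpand g 0 c rho z0 Hc Hz). rewrite Cplus_0_l in Hb'.
    assert (E : forall k, b k = PS (taylor c k) z0).
    { apply pseries_unique with (fun w => g (z0 + w)%C) (Rmin d (rho - Cmod z0)).
      apply Rmin_glb_lt; lra.
      intros w Hw. apply Hb. apply Rlt_le_trans with (1 := Hw), Rmin_l.
      intros w Hw. apply Hb'. apply Rlt_le_trans with (1 := Hw), Rmin_r. }
    split.
    - intros w Hw. generalize (Hb w Hw).
      apply (@is_series_ext C_AbsRing C_NormedModule). intros k. now rewrite E.
    - intros k. rewrite <- E. apply B. }
  (* The series will be shown to converge below [s + d / 2 = rho + 3 d / 8], and
     points of modulus below [rho + d / 4] are within [3 d / 8 < d] of the circle
     of radius [s]. *)
  set (s := rho - d / 8).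
  assert (Hs : 0 < s < rho) by (unfold s; lra).
  assert (Hcs : abs_conv c ((s + rho) / 2)) by (apply has_ps_abs_conv with (1 := Hc); lra).
  assert (T : forall k j, Cmod (taylor c k j) * s ^ j * (d / 2) ^ k <= 2 * / d * (/ 2) ^ k).
  { intros k j. assert (Hdk := pow_lt d k Hd).
    assert (B : Cmod (taylor c k j) * s ^ j <= 2 * (/ d / d ^ k)).
    { apply coef_bound. lra. apply abs_conv_taylor with ((s + rho) / 2); auto; lra.
      intros z Hz. destruct (Key z) as [_ K]. lra.
      apply Rmult_le_reg_r with (d ^ k); auto.
      replace (/ d / d ^ k * d ^ k) with (/ d) by (field; lra). apply K. }
    replace (2 * / d * (/ 2) ^ k) with (2 * (/ d / d ^ k) * (d / 2) ^ k).
    apply Rmult_le_compat_r; auto. apply pow_le; lra.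
    change (d / 2) with (d * / 2). rewrite Rpow_mult_distr. field. lra. }
  assert (Hcb : forall t, 0 <= t < s + d / 2 -> abs_conv c t).
  { intros t Ht. apply abs_conv_bounded with (s + d / 2) (2 * / d * 2); auto.
    intros n. rewrite (Rplus_comm s), Rbinomial.
    rewrite <- (sum_n_mult_l (K := R_Ring)).
    apply Rle_trans with (sum_n (fun k => mult (2 * / d) ((/ 2) ^ k)) n).
    - apply sum_n_le_loc. intros k Hk. change (mult ?a ?b) with (a * b).
      apply Rle_trans with (2 := T k (n - k)%nat). rewrite Cmod_taylor.
      replace (n - k + k)%nat with n by lia. right. ring.
    - rewrite (sum_n_mult_l (K := R_Ring)). change (mult ?a ?b) with (a * b).
      apply Rmult_le_compat_l. assert (0 < / d) by now apply Rinv_0_lt_compat. lra.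
      apply sum_half_le. }
  exists (rho + d / 4). split. lra.
  intros z Hz. destruct (Rlt_dec (Cmod z) rho) as [Hz'|Hz']. now apply Hc.
  rewrite Cplus_0_l.
  (* [z0] lies on the circle of radius [s], on the ray through [z]. *)
  set (z0 := (RtoC (s / Cmod z) * z)%C). set (w := (RtoC (1 - s / Cmod z) * z)%C).
  assert (Hq : 0 < s / Cmod z < 1).
  { split. apply Rdiv_lt_0_compat; lra. apply Rmult_lt_reg_r with (Cmod z). lra. field_simplify; lra. }
  assert (Z0 : Cmod z0 = s). { unfold z0. rewrite Cmod_mult, Cmod_RtoC_pos by lra. field; lra. }
  assert (W0 : Cmod w = Cmod z - s). { unfold w. rewrite Cmod_mult, Cmod_RtoC_pos by lra. field; lra. }
  assert (E : z = (z0 + w)%C). { unfold z0, w. rewrite RtoC_minus. ring. }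
  assert (Hz2 : Cmod z < s + d / 2) by (unfold s; lra).
  replace (g z) with (PS c z).
  - apply is_pseries_PS with (Cmod z). lra. apply Hcb. lra.
  - destruct (reexpansion c z0 w ((Cmod z + (s + d / 2)) / 2)) as [_ R2].
    rewrite Z0, W0. lra. apply Hcb. lra.
    rewrite E, <- R2. apply PS_unique. apply Key. lra. rewrite W0; unfold s in *; lra.
Qed.

(** At the supremum of the radii of validity, [extension_step] would enlarge a
    radius smaller than 1. *)
Lemma analytic_expansion g : analytic_in_disc g -> exists c, is_expansion c g.
Proof.
  intros Hg.
  destruct (analytic_has_ps g 0 Hg) as (c & r0 & Hr0 & Hc).
  { unfold in_disc. rewrite Cmod_0; lra. }
  exists c.
  set (S := fun s => s <= 1 /\ has_ps g 0 c s).
  assert (Sm : S (Rmin r0 1)).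
  { split. apply Rmin_r. intros w Hw. apply Hc. apply Rlt_le_trans with (1 := Hw), Rmin_l. }
  destruct (completeness S) as [rho [Hub Hlub]].
  - exists 1. intros s [Hs _]; auto.
  - now exists (Rmin r0 1).
  - assert (Hrho : has_ps g 0 c rho).
    { intros w Hw. apply NNPP. intros N.
      assert (rho <= Cmod w); [|lra]. apply Hlub. intros s [Hs1 Hs2].
      destruct (Rle_lt_dec s (Cmod w)); auto. exfalso. auto. }
    assert (H1 : rho = 1).
    { apply Rle_antisym. apply Hlub. intros s [Hs _]; auto.
      apply Rnot_lt_le. intros Hlt.
      assert (P : 0 < rho).
      { apply Rlt_le_trans with (Rmin r0 1). apply Rmin_glb_lt; lra. now apply Hub. }
      destruct (extension_step g c rho Hg (conj P Hlt) Hrho) as (r' & Hr' & H').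
      assert (Rmin r' 1 <= rho).
      { apply Hub. split. apply Rmin_r. intros w Hw. apply H'.
        apply Rlt_le_trans with (1 := Hw), Rmin_l. }
      assert (rho < Rmin r' 1) by (apply Rmin_glb_lt; lra). lra. }
    intros z Hz. rewrite <- (Cplus_0_l z) at 2. apply Hrho. rewrite H1. exact Hz.
Qed.

(** * Differentiation *)

Lemma has_ps_first_order g z b rho : 0 < rho -> has_ps g z b rho ->
  exists A t, 0 <= A /\ 0 < t /\ forall w, Cmod w < t -> w <> 0 ->
    Cmod ((g (z + w) - g z) / w - b 1%nat)%C <= A * Cmod w.
Proof.
  intros Hr H. set (t := rho / 2).
  assert (Ht : 0 < t) by (unfold t; lra).
  assert (Hb : abs_conv b t) by (apply has_ps_abs_conv with (1 := H); unfold t; lra).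
  assert (Hb1 := abs_conv_tail b t Ht Hb). assert (Hb2 := abs_conv_tail _ t Ht Hb1).
  exists (Series (fun n => Cmod (b (S (S n))) * t ^ n)), t.
  split; [|split]; auto.
  { apply Series_nonneg; auto. intros n. apply Rmult_le_pos. apply Cmod_ge_0. apply pow_le; lra. }
  intros w Hw Nw.
  assert (G : forall u, Cmod u < rho -> g (z + u)%C = PS b u).
  { intros u Hu. symmetry. now apply PS_unique, H. }
  assert (G0 : g z = b 0%nat).
  { rewrite <- (PS_0 b), <- G, Cplus_0_r. reflexivity. rewrite Cmod_0; auto. }
  assert (Hwt : Cmod w <= t) by lra.
  rewrite G0, G by (unfold t in *; lra).
  rewrite (PS_incr b w t Hwt Ht Hb), (PS_incr _ w t Hwt Ht Hb1).
  match goal with |- Cmod (?a) <= _ => replace a with (PS (fun n => b (S (S n))) w * w)%C by (field; auto) end.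
  rewrite Cmod_mult. apply Rmult_le_compat_r. apply Cmod_ge_0. now apply Cmod_PS_le.
Qed.

(** The complex derivative is read off the power series at the point itself:
    by [has_ps_first_order] the difference quotient differs from [b 1] by
    [O(|w|)]. *)
Lemma C_derive_ps g z b rho : 0 < rho -> has_ps g z b rho -> C_derive g z = b 1%nat.
Proof.
  intros Hr H. destruct (has_ps_first_order g z b rho Hr H) as (A & t & HA & Ht & B).
  apply is_C_lim_unique. apply filterlim_locally. intros eps.
  set (e := Rmin t (eps / (A + 1)) / 2).
  assert (He0 : 0 < eps / (A + 1)) by (apply Rdiv_lt_0_compat; [apply cond_pos|lra]).
  assert (He1 := Rmin_l t (eps / (A + 1))). assert (He2 := Rmin_r t (eps / (A + 1))).
  assert (He : 0 < e). { unfold e. assert (0 < Rmin t (eps / (A + 1))) by now apply Rmin_glb_lt. lra. }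
  exists (mkposreal e He).
  enough (Q : forall x : CC, ball z e x -> x <> z -> ball (b 1%nat) eps ((g x - g z) / (x - z))%C)
    by exact Q.
  intros x Hx Nx.
  apply (C_NormedModule_mixin_compat2 z x (mkposreal e He)) in Hx. simpl in Hx.
  assert (S2 : sqrt 2 <= 2).
  { rewrite <- (sqrt_square 2) at 2 by lra. apply sqrt_le_1_alt. lra. }
  set (w := (x - z)%C). assert (Hw : Cmod w < 2 * e).
  { apply Rlt_le_trans with (1 := Hx). apply Rmult_le_compat_r; lra. }
  assert (Nw : w <> 0). { intros E. apply Nx. now apply Ceq_minus. }
  apply C_NormedModule_mixin_compat1.
  assert (D := B w ltac:(unfold e in *; lra) Nw). replace (z + w)%C with x in D by (unfold w; ring).
  apply Rle_lt_trans with (1 := D).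
  apply Rle_lt_trans with (A * (eps / (A + 1))).
  apply Rmult_le_compat_l; auto. unfold e in *; lra.
  apply Rmult_lt_reg_r with (A + 1). lra.
  replace (A * (eps / (A + 1)) * (A + 1)) with (A * eps) by (field; lra).
  generalize (cond_pos eps). lra.
Qed.

Lemma is_expansion_has_ps c g : is_expansion c g <-> has_ps g 0 c 1.
Proof.
  split; intros H z Hz.
  - rewrite Cplus_0_l. now apply H.
  - rewrite <- (Cplus_0_l z) at 2. now apply H.
Qed.

Lemma is_expansion_abs_conv c g t : is_expansion c g -> 0 <= t < 1 -> abs_conv c t.
Proof. intros H. apply is_expansion_has_ps in H. now apply has_ps_abs_conv with (1 := H). Qed.

Lemma is_expansion_PS c g z : is_expansion c g -> in_disc z -> g z = PS c z.
Proof. intros H Hz. symmetry. now apply PS_unique, H. Qed.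

(** The derivative at [z] is the first coefficient of the re-expansion at [z],
    and as a function of [z] this is the sum of [taylor c 1]. *)
Lemma C_derive_expansion c g : is_expansion c g -> is_expansion (taylor c 1) (C_derive g).
Proof.
  intros H z Hz. assert (H' := proj1 (is_expansion_has_ps c g) H).
  assert (D := has_ps_reexpand g 0 c 1 z H' Hz). rewrite Cplus_0_l in D.
  rewrite (C_derive_ps _ _ _ (1 - Cmod z) ltac:(unfold in_disc in Hz; lra) D).
  unfold in_disc in Hz. assert (P := Cmod_ge_0 z).
  apply is_pseries_PS with (Cmod z). lra.
  apply abs_conv_taylor with ((Cmod z + 1) / 2). lra.
  apply is_expansion_abs_conv with g; auto. lra.
Qed.

Lemma coefs_expansion c g : is_expansion c g -> forall n, coefs g n = c n.
Proof.
  intros H.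
  assert (H' : is_expansion (coefs g) g).
  { unfold coefs. apply epsilon_spec. now exists c. }
  apply pseries_unique with g 1. lra. exact H'. exact H.
Qed.

Lemma Cmod_taylor_1 c n : Cmod (taylor c 1 n) = INR (S n) * Cmod (c (S n)).
Proof. now rewrite Cmod_taylor, Nat.add_1_r, binom_S_1. Qed.

Lemma Bohr_derive c g r : is_expansion c g ->
  Bohr r (C_derive g) = Series (fun n => INR (S n) * Cmod (c (S n)) * r ^ n).
Proof.
  intros H. unfold Bohr. apply Series_ext. intros n.
  now rewrite (coefs_expansion _ _ (C_derive_expansion c g H)), Cmod_taylor_1.
Qed.

Lemma ex_series_derive c g r : is_expansion c g -> 0 <= r < 1 ->
  ex_series (fun n => INR (S n) * Cmod (c (S n)) * r ^ n).
Proof.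
  intros H Hr. generalize (is_expansion_abs_conv _ _ r (C_derive_expansion c g H) Hr).
  apply ex_series_ext. intros n. now rewrite Cmod_taylor_1.
Qed.

(** * Powers of a Schwarz function *)

(** For [q] the coefficients of [psi^N] the estimate on the circle of radius [s] is only
    [(/ s) ^ N], obtained from [|phi| <= 1] by dividing [phi^N] by [z^N].
    Carathéodory's inequality on these circles becomes, in the limit
    [s -> 1], the one for functions bounded by 1; this is where the Schwarz
    lemma for [phi] is hidden. *)
Lemma caratheodory_unit_disc (q : nat -> CC) (N k : nat) :
  (forall t, 0 <= t < 1 -> abs_conv q t) ->
  (forall z, 0 < Cmod z < 1 -> Cmod (PS q z) <= (/ Cmod z) ^ N) ->
  (1 <= k)%nat -> Cmod (q k) <= 2 * (1 - Cmod (q 0%nat)).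
Proof.
  intros Hq HB Hk.
  assert (E : forall m, Cmod (q k) * (1 - / INR (S (S m))) ^ k <=
     2 * ((/ (1 - / INR (S (S m)))) ^ N - Cmod (q 0%nat))).
  { intros m. assert (Hm : 1 < INR (S (S m))) by (rewrite !S_INR; generalize (pos_INR m); lra).
    assert (0 < / INR (S (S m)) < 1).
    { split. apply Rinv_0_lt_compat; lra. rewrite <- Rinv_1. apply Rinv_lt_contravar; lra. }
    apply caratheodory; auto. lra. apply Hq; lra.
    intros z Hz. rewrite <- Hz. apply HB. lra. }
  assert (L : is_lim_seq (fun m => 1 - / INR (S (S m))) 1).
  { replace (Finite 1) with (Finite (1 - 0)) by (f_equal; ring).
    apply is_lim_seq_minus'. apply is_lim_seq_const.
    apply (is_lim_seq_incr_1 (fun m => / INR (S m))), (is_lim_seq_incr_1 (fun m => / INR m)).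
    apply (is_lim_seq_inv _ _ is_lim_seq_INR). discriminate. }
  assert (L1 := is_lim_seq_continuous (fun x => Cmod (q k) * x ^ k) _ _ ltac:(reg) L).
  assert (L2 := is_lim_seq_continuous (fun x => 2 * ((/ x) ^ N - Cmod (q 0%nat))) _ _ ltac:(reg; exact R1_neq_R0) L).
  assert (F := is_lim_seq_le _ _ _ _ E L1 L2). simpl in F.
  rewrite Rinv_1, !pow1 in F. lra.
Qed.

(** The Taylor coefficients of [(phi z / z) ^ n] when [p] are those of [phi]
    and [phi 0 = 0]. *)
Definition psi_pow (p : nat -> CC) (n : nat) : nat -> CC := conv_pow (fun k => p (S k)) n.

Lemma abs_conv_tail_all p : (forall t, 0 <= t < 1 -> abs_conv p t) ->
  forall t, 0 <= t < 1 -> abs_conv (fun k => p (S k)) t.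
Proof.
  intros H t Ht. apply abs_conv_le with ((t + 1) / 2). lra.
  apply abs_conv_tail. lra. apply H. lra.
Qed.

Lemma Schwarz_power phi p n z : is_expansion p phi -> phi (RtoC 0) = RtoC 0 -> in_disc z ->
  (phi z ^ n)%C = (z ^ n * PS (psi_pow p n) z)%C.
Proof.
  intros Hp H0 Hz. unfold in_disc in Hz. assert (Z := Cmod_ge_0 z).
  assert (Ha := fun t => is_expansion_abs_conv p phi t Hp).
  assert (P0 : p 0%nat = 0).
  { rewrite <- H0, <- (PS_0 p). symmetry. apply is_expansion_PS; auto.
    unfold in_disc. rewrite Cmod_0; lra. }
  unfold psi_pow. rewrite PS_conv_pow by (apply abs_conv_tail_all; auto).
  rewrite <- Cpow_mult_l. f_equal.
  rewrite (is_expansion_PS p phi z Hp Hz).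
  rewrite (PS_incr p z ((Cmod z + 1) / 2)) by (try lra; apply Ha; lra).
  rewrite P0. ring.
Qed.

Lemma abs_conv_psi_pow phi p n t : is_expansion p phi -> 0 <= t < 1 -> abs_conv (psi_pow p n) t.
Proof.
  intros Hp Ht. apply abs_conv_conv_pow. lra. apply abs_conv_tail_all; auto. intros s; now apply is_expansion_abs_conv with phi.
Qed.

Lemma Schwarz_power_coef phi p n k : Schwarz_function phi -> is_expansion p phi ->
  (1 <= k)%nat -> Cmod (psi_pow p n k) <= 2 * (1 - Cmod (psi_pow p n 0%nat)).
Proof.
  intros (_ & Hd & H0) Hp Hk. apply caratheodory_unit_disc with n; auto.
  - intros t Ht. now apply abs_conv_psi_pow with phi.
  - intros z Hz. rewrite pow_inv.
    assert (Hz' : in_disc z) by (unfold in_disc; lra).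
    assert (E := f_equal Cmod (Schwarz_power phi p n z Hp H0 Hz')).
    rewrite Cmod_mult, !Cmod_pow in E.
    assert (Hzn := pow_lt (Cmod z) n (proj1 Hz)).
    apply Rmult_le_reg_l with (Cmod z ^ n); auto. rewrite <- E, Rinv_r by lra.
    rewrite <- (pow1 n). apply pow_incr. split. apply Cmod_ge_0. apply Rlt_le, Hd, Hz'.
Qed.

Lemma Schwarz_power_coef_0_le_1 phi p n : Schwarz_function phi -> is_expansion p phi ->
  Cmod (psi_pow p n 0%nat) <= 1.
Proof.
  intros HS Hp. assert (H := Schwarz_power_coef phi p n 1 HS Hp (le_n _)).
  assert (H1 := Cmod_ge_0 (psi_pow p n 1%nat)). lra.
Qed.

Lemma Schwarz_power_coef_le_2 phi p n k : Schwarz_function phi -> is_expansion p phi ->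
  Cmod (psi_pow p n k) <= 2.
Proof.
  intros HS Hp. assert (H0 := Schwarz_power_coef_0_le_1 phi p n HS Hp).
  destruct k. lra.
  assert (H := Schwarz_power_coef phi p n (S k) HS Hp ltac:(lia)).
  assert (H1 := Cmod_ge_0 (psi_pow p n 0%nat)). lra.
Qed.

(** * Composition *)

Definition comp_coef (a p : nat -> CC) (m : nat) : CC :=
  sum_n (fun n => a n * psi_pow p n (m - n)%nat)%C m.

(** Since the coefficients of [psi^n] are at most 2, the family
    [a_n z^n q_(n,j) z^j] is dominated by [|a_n| |z|^n * 2 |z|^j] on the whole
    disc and may be summed along anti-diagonals. *)
Lemma composition_expansion h phi a p : Schwarz_function phi ->
  is_expansion a h -> is_expansion p phi ->
  is_expansion (comp_coef a p) (fun z => h (phi z)).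
Proof.
  intros HS Ha Hp z Hz. assert (Z := Cmod_ge_0 z).
  pose proof HS as (_ & Hd & H0).
  set (v := fun n j => ((a n * z ^ n) * (psi_pow p n j * z ^ j))%C).
  assert (S2 : summable2 (fun n j => Cmod (v n j))).
  { apply summable2_le with (fun n j => (Cmod (a n) * Cmod z ^ n) * (2 * Cmod z ^ j)).
    - intros n j; split. apply Cmod_ge_0. unfold v. rewrite Cmod_mult, !Cmod_term.
      apply Rmult_le_compat_l. apply Rmult_le_pos. apply Cmod_ge_0. now apply pow_le.
      apply Rmult_le_compat_r. now apply pow_le. now apply Schwarz_power_coef_le_2 with phi.
    - apply (summable2_product (fun n => Cmod (a n) * Cmod z ^ n) (fun j => 2 * Cmod z ^ j)).
      apply (is_expansion_abs_conv a h _ Ha). split; auto.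
      apply (ex_series_scal_l 2 (fun j => Cmod z ^ j)). apply ex_series_geom.
      rewrite Rabs_pos_eq; auto. }
  apply is_pseries_Cseries.
  assert (D := Cdiag_series v S2).
  replace (h (phi z)) with (CSeries (fun n => CSeries (v n))).
  - revert D. apply (@is_series_ext C_AbsRing C_NormedModule). intros m.
    unfold comp_coef. rewrite sum_n_Cmult_r. apply sum_n_ext_loc. intros n Hn. unfold v.
    replace (z ^ m)%C with (z ^ n * z ^ (m - n))%C by (rewrite <- Cpow_add_r; f_equal; lia).
    C_eq. ring.
  - rewrite (is_expansion_PS a h (phi z) Ha (Hd z Hz)). apply CSeries_ext. intros n.
    rewrite (Schwarz_power phi p n z Hp H0 Hz). unfold v, PS.
    rewrite CSeries_scal. ring.
    apply abs_conv_terms. apply abs_conv_psi_pow with phi; auto.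
Qed.

(** The constant term of [h] contributes only to the constant term of
    [h o phi]. *)
Lemma comp_coef_S a p m : comp_coef a p (S m) =
  sum_n (fun k => a (S k) * psi_pow p (S k) (m - k)%nat)%C m.
Proof.
  unfold comp_coef. rewrite sum_n_first. simpl. rewrite Cmult_0_r. apply Cplus_0_l.
Qed.

(** * The Bohr inequality *)

Lemma S_le_pow2 j : INR (S j) <= 2 ^ j.
Proof.
  induction j. simpl; lra. rewrite S_INR. simpl pow.
  assert (1 <= 2 ^ j) by (apply pow_R1_Rle; lra). lra.
Qed.

(** By [1 + j <= 2^j] and [2 r <= 1/3] the terms are dominated by [|q_0|]
    followed by the geometric series [B / 3^j] with [B = 2 (1 - |q_0|)], whose
    total is [|q_0| + B / 2 = 1]. *)
Lemma weighted_coef_sum (q : nat -> CC) r : 0 <= r <= 1 / 6 -> Cmod (q 0%nat) <= 1 ->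
  (forall k, (1 <= k)%nat -> Cmod (q k) <= 2 * (1 - Cmod (q 0%nat))) ->
  ex_series (fun j => Cmod (q j) * INR (S j) * r ^ j) /\
  Series (fun j => Cmod (q j) * INR (S j) * r ^ j) <= 1.
Proof.
  intros Hr H0 Hq. set (B := 2 * (1 - Cmod (q 0%nat))).
  set (y := fun j => match j with O => Cmod (q 0%nat) | S i => (B * / 3) * (/ 3) ^ i end).
  assert (Y : is_series y 1).
  { apply (is_series_decr_1 y). unfold y.
    replace (plus _ _) with (B * / 3 * / (1 - / 3))
      by (unfold B, plus, opp; simpl; field).
    apply (is_series_scal_l (B * / 3) (fun i => (/ 3) ^ i)). apply is_series_geom.
    rewrite Rabs_pos_eq; lra. }
  assert (L : forall j, 0 <= Cmod (q j) * INR (S j) * r ^ j <= y j).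
  { intros j. assert (Hrj : 0 <= r ^ j) by (apply pow_le; lra).
    assert (Hj := pos_INR (S j)). assert (Hc := Cmod_ge_0 (q j)).
    split. apply Rmult_le_pos; auto. now apply Rmult_le_pos.
    destruct j as [|i]. simpl; lra.
    unfold y. rewrite Rmult_assoc, (Rmult_assoc B). change (/ 3 * (/ 3) ^ i) with ((/ 3) ^ S i).
    apply Rmult_le_compat; auto. now apply Rmult_le_pos. apply Hq; lia.
    apply Rle_trans with (2 ^ S i * r ^ S i).
    apply Rmult_le_compat_r; auto. apply S_le_pow2.
    rewrite <- Rpow_mult_distr. apply pow_incr. lra. }
  assert (E : ex_series y) by now exists 1.
  split. apply ex_series_le_pos with y; auto.
  rewrite <- (is_series_unique _ _ Y). now apply Series_le.
Qed.

Lemma radius_le_sixth : 1 / 3 * (1 - sqrt (2 / 3)) <= 1 / 6.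
Proof.
  assert (H : 1 / 2 <= sqrt (2 / 3)); [|lra].
  rewrite <- (sqrt_square (1 / 2)) by lra. apply sqrt_le_1_alt. lra.
Qed.

Theorem theorem4 (h : CC -> CC) (r : R) :
  analytic_in_disc h ->
  0 <= r <= 1 / 3 * (1 - sqrt (2 / 3)) ->
  forall phi : CC -> CC, Schwarz_function phi ->
    Bohr r (C_derive (fun z : CC => h (phi z))) <= Bohr r (C_derive h).
Proof.
  intros Hh Hr phi HS. assert (R6 := radius_le_sixth).
  destruct (analytic_expansion h Hh) as [a Ha].
  destruct (analytic_expansion phi (proj1 HS)) as [p Hp].
  rewrite (Bohr_derive _ _ r Ha).
  rewrite (Bohr_derive _ _ r (composition_expansion h phi a p HS Ha Hp)).
  assert (EA := ex_series_derive a h r Ha ltac:(lra)).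
  (* Index [k] stands for [n = S k], as the derivative loses the term [n = 0]:
     [w k j] is the contribution of the coefficient [q_(n,j)], of degree [k + j]
     after differentiation. *)
  set (A := fun k => INR (S k) * Cmod (a (S k)) * r ^ k) in *.
  set (x := fun k j => Cmod (psi_pow p (S k) j) * INR (S j) * r ^ j).
  set (w := fun k j => Cmod (a (S k) * psi_pow p (S k) j) * INR (S (k + j)) * r ^ (k + j)).
  assert (HA : forall k, 0 <= A k).
  { intros k. unfold A. apply Rmult_le_pos; [|apply pow_le; lra].
    apply Rmult_le_pos. apply pos_INR. apply Cmod_ge_0. }
  assert (Hx : forall k, ex_series (x k) /\ Series (x k) <= 1).
  { intros k. apply weighted_coef_sum. lra. now apply Schwarz_power_coef_0_le_1 with phi.
    intros j Hj. now apply Schwarz_power_coef with phi. }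
  assert (Hw0 : forall k j, 0 <= w k j).
  { intros k j. apply Rmult_le_pos; [|apply pow_le; lra].
    apply Rmult_le_pos. apply Cmod_ge_0. apply pos_INR. }
  assert (Hwx : forall k j, w k j <= A k * x k j).
  { intros k j. unfold w, A, x. rewrite Cmod_mult, pow_add.
    assert (I : INR (S (k + j)) <= INR (S k) * INR (S j)).
    { rewrite <- mult_INR. apply le_INR. lia. }
    replace (INR (S k) * Cmod (a (S k)) * r ^ k * (Cmod (psi_pow p (S k) j) * INR (S j) * r ^ j))
      with (Cmod (a (S k)) * Cmod (psi_pow p (S k) j) * (INR (S k) * INR (S j)) * (r ^ k * r ^ j)) by ring.
    apply Rmult_le_compat_r. apply Rmult_le_pos; apply pow_le; lra.
    apply Rmult_le_compat_l; auto. apply Rmult_le_pos; apply Cmod_ge_0. }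
  assert (Hwrow : forall k, ex_series (w k) /\ Series (w k) <= A k).
  { intros k. destruct (Hx k) as [X1 X2].
    assert (X3 : ex_series (fun j => A k * x k j)) by apply (ex_series_scal_l (A k) (x k) X1).
    split. apply ex_series_le_pos with (fun j => A k * x k j); auto.
    apply Rle_trans with (Series (fun j => A k * x k j)). apply Series_le; auto.
    rewrite Series_scal_l. rewrite <- (Rmult_1_r (A k)) at 2.
    apply Rmult_le_compat_l; auto. }
  assert (S2 : summable2 w).
  { split. apply Hwrow. apply ex_series_le_pos with A; auto. intros k; split.
    apply Series_nonneg; auto. apply Hwrow. apply Hwrow. }
  assert (D := diag_series w w (fun k j => Req_le _ _ (Rabs_pos_eq _ (Hw0 k j))) S2).
  apply Rle_trans with (Series (fun n => sum_n (fun k => w k (n - k)%nat) n)).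
  - apply Series_le; [|eexists; exact D]. intros m. split.
    + apply Rmult_le_pos; [|apply pow_le; lra].
      apply Rmult_le_pos. apply pos_INR. apply Cmod_ge_0.
    + rewrite comp_coef_S.
      apply Rle_trans with (INR (S m) * sum_n (fun k => Cmod (a (S k) * psi_pow p (S k) (m - k)%nat)) m * r ^ m).
      * apply Rmult_le_compat_r. apply pow_le; lra.
        apply Rmult_le_compat_l. apply pos_INR. apply Cmod_sum_n.
      * right. rewrite (Rmult_comm (INR _)), Rmult_assoc.
        rewrite <- (sum_n_mult_r (K := R_Ring)). apply sum_n_ext_loc. intros k Hk.
        unfold w. replace (k + (m - k))%nat with m by lia. symmetry; apply Rmult_assoc.
  - rewrite (is_series_unique _ _ D). apply Series_le; auto.
    intros k; split. apply Series_nonneg; auto. apply Hwrow. apply Hwrow.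
Qed.
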